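(* Let $n_1,n_2,n_3\ge 2$, $r\le\min\{n_1,n_2\}$, $b,c>0$, and let $\mathcal{X}^*=\mathcal{A}^*\diamond\mathcal{B}^*\in\mathbb{R}_+^{n_1\times n_2\times n_3}$ with $\mathcal{A}^*\in\mathbb{R}_+^{n_1\times r\times n_3}$, $\mathcal{B}^*\in\mathbb{R}_+^{r\times n_2\times n_3}$, $0\le\mathcal{X}^*_{ijk}\le c/2$, $0\le\mathcal{A}^*_{ijk}\le 1$, $0\le\mathcal{B}^*_{ijk}\le b$. Let $4\le m\le n_1n_2n_3$, $\gamma=\frac{m}{n_1n_2n_3}$, and let $\Omega\sim\mathrm{Bern}(\gamma)$; given $\Omega$, let the observations $\mathcal{Y}_\Omega$ have joint density/mass function $p_{\mathcal{X}^*_\Omega}(\mathcal{Y}_\Omega)=\prod_{(i,j,k)\in\Omega}p_{\mathcal{X}^*_{ijk}}(\mathcal{Y}_{ijk})$. Fix $\beta\ge 3$ and let $\Gamma$ and $\widetilde{\mathcal{X}}^\lambda$ be as in the context. Suppose $\kappa\ge\max_{\mathcal{X}\in\Gamma}\max_{i,j,k}D(p_{\mathcal{X}^*_{ijk}}\|p_{\mathcal{X}_{ijk}})$. Then for any $\lambda\ge 4(\beta+2)\left(1+\frac{2\kappa}{3}\right)\log\left((n_1\vee n_2)\sqrt{n_3}\right)$, the estimator $\widetilde{\mathcal{X}}^\lambda$ satisfies \[ \frac{\mathbb{E}_{\Omega,\mathcal{Y}_\Omega}[-2\log H(p_{\widetilde{\mathcal{X}}^\lambda},p_{\mathcal{X}^*})]}{n_1n_2n_3}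 \le 3\min_{\mathcal{X}=\mathcal{A}\diamond\mathcal{B}\in\Gamma}\left\{\frac{D(p_{\mathcal{X}^*}\|p_{\mathcal{X}})}{n_1n_2n_3}+\left(\lambda+\frac{8\kappa(\beta+2)\log((n_1\vee n_2)\sqrt{n_3})}{3}\right)\frac{rn_1n_3+\|\mathcal{B}\|_0}{m}\right\}+\frac{8\kappa\log(m)}{m}. \]
   Context: Tensor-tensor product: for $\mathcal{X}\in\mathbb{R}^{n_1\times n_2\times n_3}$ with frontal slices $\mathbf{X}^{(1)},\dots,\mathbf{X}^{(n_3)}$ and $\mathcal{Y}\in\mathbb{R}^{n_2\times n_4\times n_3}$, $\mathcal{X}\diamond\mathcal{Y}\in\mathbb{R}^{n_1\times n_4\times n_3}$ is obtained by multiplying the block-circulant matrix whose $(p,q)$ block is $\mathbf{X}^{((p-q)\bmod n_3+1)}$ by the vertical stack of the frontal slices of $\mathcal{Y}$, and folding the resulting $n_1n_3\times n_4$ block column back into frontal slices. $\|\mathcal{B}\|_0$ is the number of nonzero entries; $m\vee n=\max\{m,n\}$. $\Omega\sim\mathrm{Bern}(\gamma)$ means each index $(i,j,k)$ belongs to $\Omega$ independently with probability $\gamma$. $\{p_x\}$ is a scalar parametric family of densities or mass functions; $D(p\|q)=\mathbb{E}_p[\log(p/q)]$ (KL divergence), $H(p,q)=\mathbb{E}_p[\sqrt{q/p}]$ (Hellinger affinity); for tensors, $D(p_{\mathcal{X}_1}\|p_{\mathcal{X}_2})=\sum_{i,j,k}D(p_{(\mathcal{X}_1)_{ijk}}\|p_{(\mathcal{X}_2)_{ijk}})$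 and $H(p_{\mathcal{X}_1},p_{\mathcal{X}_2})=\prod_{i,j,k}H(p_{(\mathcal{X}_1)_{ijk}},p_{(\mathcal{X}_2)_{ijk}})$. Let $\vartheta=2^{\lceil\beta\log_2(n_1\vee n_2)\rceil}$. $\mathfrak{L}$ is the set of tensors in $\mathbb{R}_+^{n_1\times r\times n_3}$ each of whose entries is one of $\vartheta$ uniformly spaced discretization levels of $[0,1]$; $\mathfrak{D}$ is the set of tensors in $\mathbb{R}_+^{r\times n_2\times n_3}$ each of whose entries is either $0$ or one of $\vartheta$ uniformly spaced discretization levels of $[0,b]$. $\Gamma=\{\mathcal{X}=\mathcal{A}\diamond\mathcal{B}:\mathcal{A}\in\mathfrak{L},\mathcal{B}\in\mathfrak{D},0\le\mathcal{X}_{ijk}\le c\ \forall i,j,k\}$. The estimator is $\widetilde{\mathcal{X}}^\lambda\in\arg\min_{\mathcal{X}=\mathcal{A}\diamond\mathcal{B}\in\Gamma}\{-\log p_{\mathcal{X}_\Omega}(\mathcal{Y}_\Omega)+\lambda\|\mathcal{B}\|_0\}$, where $p_{\mathcal{X}_\Omega}(\mathcal{Y}_\Omega)=\prod_{(i,j,k)\in\Omega}p_{\mathcal{X}_{ijk}}(\mathcal{Y}_{ijk})$. *)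

(* Defs.v *)
From HB Require Import structures.
From mathcomp Require Import all_boot all_order all_algebra.
From mathcomp Require Import all_classical all_reals all_analysis.
Set Implicit Arguments.
Unset Strict Implicit.
Unset Printing Implicit Defensive.
Import Order.TTheory GRing.Theory Num.Theory.
Local Open Scope classical_set_scope.
Local Open Scope ring_scope.

Definition tensor (R : Type) (n1 n2 n3 : nat) := 'I_n1 -> 'I_n2 -> 'I_n3 -> R.

Definition tidx (n1 n2 n3 : nat) := ('I_n1 * 'I_n2 * 'I_n3)%type.

Definition tent (R : Type) n1 n2 n3 (X : tensor R n1 n2 n3) (t : tidx n1 n2 n3) : R :=
  X t.1.1 t.1.2 t.2.

Definition csub (n : nat) (k q : 'I_n) : 'I_n :=
  Ordinal (ltn_pmod (k + n - q) (leq_ltn_trans (leq0n k) (ltn_ord k))).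

(* Tensor-tensor product: block-circulant matrix of X (block (p,q) is the
   frontal slice X^((p-q) mod n3)) times the stacked frontal slices of Y. *)
Definition tprod (R : pzRingType) n1 n2 n4 n3
  (X : tensor R n1 n2 n3) (Y : tensor R n2 n4 n3) : tensor R n1 n4 n3 :=
  fun i l k => \sum_(q < n3) \sum_(j < n2) X i j (csub k q) * Y j l q.

Definition l0norm (R : pzRingType) n1 n2 n3 (B : tensor R n1 n2 n3) : nat :=
  #|[set t : tidx n1 n2 n3 | tent B t != 0]|.

Section Model.
Variable R : realType.

Definition log2 (x : R) : R := ln x / ln 2.

Definition vartheta (beta : R) (n1 n2 : nat) : nat :=
  (2 ^ `|Num.ceil (beta * log2 (maxn n1 n2)%:R)|)%N.

Definition is_level (vt : nat) (a x : R) : Prop :=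
  exists2 l : nat, (l < vt)%N & x = a * l%:R / (vt.-1)%:R.

Definition inL (vt : nat) n1 r n3 (A : tensor R n1 r n3) : Prop :=
  forall i j k, is_level vt 1 (A i j k).

Definition inD (vt : nat) (b : R) r n2 n3 (B : tensor R r n2 n3) : Prop :=
  forall i j k, B i j k = 0 \/ is_level vt b (B i j k).

Definition inGamma (vt : nat) (b c : R) n1 n2 n3 r
  (A : tensor R n1 r n3) (B : tensor R r n2 n3) : Prop :=
  [/\ inL vt A, inD vt b B &
      forall i j k, 0 <= tprod A B i j k <= c].

Context d (Ys : measurableType d) (mu : {measure set Ys -> \bar R}).

Definition KL (p q : Ys -> R) : \bar R :=
  if `[< {ae mu, forall y, q y = 0 -> p y = 0} >]
  then (\int[mu]_y (p y * ln (p y / q y))%:E)%E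
  else +oo%E.

(* Hellinger affinity H(p,q) = E_p[sqrt(q/p)] = int sqrt(p q) dmu *)
Definition hell (p q : Ys -> R) : R :=
  fine (\int[mu]_y (Num.sqrt (p y * q y))%:E)%E.

Definition m2log (h : R) : \bar R :=
  if 0 < h then (- 2 * ln h)%:E else +oo%E.

Definition mlog (v : R) : \bar R :=
  if 0 < v then (- ln v)%:E else +oo%E.

Variable p : R -> Ys -> R.

Definition tKL n1 n2 n3 (X1 X2 : tensor R n1 n2 n3) : \bar R :=
  (\sum_(t : tidx n1 n2 n3) KL (p (tent X1 t)) (p (tent X2 t)))%E.

Definition thell n1 n2 n3 (X1 X2 : tensor R n1 n2 n3) : R :=
  \prod_(t : tidx n1 n2 n3) hell (p (tent X1 t)) (p (tent X2 t)).

Definition negloglik n1 n2 n3 (X : tensor R n1 n2 n3)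
  (Om : {set tidx n1 n2 n3}) (y : tidx n1 n2 n3 -> Ys) : \bar R :=
  (\sum_(t in Om) mlog (p (tent X t) (y t)))%E.

Definition crit (lam : R) n1 n2 n3 r (A : tensor R n1 r n3) (B : tensor R r n2 n3)
  (Om : {set tidx n1 n2 n3}) (y : tidx n1 n2 n3 -> Ys) : \bar R :=
  (negloglik (tprod A B) Om y + (lam * (l0norm B)%:R)%:E)%E.

End Model.

(* Mutual independence of the random variables (Yv t)_t and the indicator
   variables (1[Om t])_t, all 2|I| of them jointly: product rule for all
   measurable rectangles (whole-space factors give every subfamily). *)
Definition mutually_indep (R : realType) dT (T : measurableType dT)
  (P : probability T R) (I : finType) dY (Ys : measurableType dY)
  (Yv : I -> T -> Ys) (Om : I -> set T) : Prop :=
  forall (A : I -> set Ys) (S : I -> set bool),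
    (forall t, measurable (A t)) ->
    P (\bigcap_(t in [set: I])
         (Yv t @^-1` A t `&` [set w | `[< Om t w >] \in S t])) =
    (\prod_(t : I) (P (Yv t @^-1` A t) * P [set w | `[< Om t w >] \in S t]))%E.

Definition omset (I : finType) (T : Type) (Om : I -> set T) (w : T) : {set I} :=
  finset (fun t => `[< Om t w >]).

(* Main.v *)
Require Import Defs.
From HB Require Import structures.
From mathcomp Require Import all_boot all_order all_algebra.
From mathcomp Require Import all_classical all_reals all_analysis.
From mathcomp Require Import measurable_realfun ring lra.
Import Order.TTheory GRing.Theory Num.Theory.
Local Open Scope classical_set_scope.
Local Open Scope ring_scope.

Set Implicit Arguments.
Unset Strict Implicit.
Unset Printing Implicit Defensive.

(* The estimator is analysed through one exponential moment instead of
   concentration inequalities.  Write f for the true density, h_k for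
   -2 log H(k, true), pen_k = 2 (beta + 2) L (r n1 n3 + |B|_0) with
   L = log ((n1 v n2) sqrt n3), and theta = 1 / (1 + 2 kappa / 3).  Averaging
   over both Omega and Y, the tilted likelihood ratio
     Z_k = exp (gamma (theta / 2) h_k / (1 + theta kappa / 2) - pen_k)
           prod_(t in Omega) (q_k / f)^(theta / 2)
   satisfies E Z_k <= exp (- pen_k): each factor has mean at most
   1 - gamma + gamma H^theta, and h_k <= D_k <= kappa turns this into a power of
   e linear in h_k.  The Kraft inequality sum_k exp (- pen_k) <= 1 then bounds
   E (sum_k Z_k) by 1, and Z_khat >= 1 + log Z_khat together with the optimality
   of khat gives gamma E h_khat <= 7/4 (gamma D_k + lambda (r n1 n3 + |B_k|_0))
   for every k, which is stronger than the claim. *)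

(** * Change of variables for integrals, from indicators to nonnegative functions *)

Section transfer.
Local Open Scope ereal_scope.
Import HBNNSimple.

Lemma integral_nnsfun_approxM (R : realType) d1 d2 (T1 : measurableType d1)
    (T2 : measurableType d2) (m1 : {measure set T1 -> \bar R}) (Y : T1 -> T2)
    (F : T1 -> R) (phi : T2 -> \bar R)
    (mphi : measurable_fun [set: T2] phi) :
  measurable_fun [set: T1] Y -> measurable_fun [set: T1] F ->
  (forall x, (0 <= F x)%R) -> (forall y, 0 <= phi y) ->
  \int[m1]_x (phi (Y x) * (F x)%:E) =
  limn (fun n => \int[m1]_x (nnsfun_approx measurableT mphi n (Y x) * F x)%:E).
Proof.
move=> mY mF F0 phi0.
rewrite -monotone_convergence//.
- apply: eq_integral => x _; apply/esym/cvg_lim => //.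
  have := @cvg_nnsfun_approx _ _ _ _ measurableT _ mphi (fun y _ => phi0 y) (Y x) I.
  move=> cph; under eq_fun do rewrite EFinM.
  exact: cvgeZr.
- move=> n; apply/measurable_EFinP; apply: measurable_funM => //.
  exact: measurableT_comp.
- by move=> n x _; rewrite lee_fin mulr_ge0// fun_ge0.
- move=> x _ a b ab; rewrite lee_fin ler_wpM2r//.
  exact/lefP/nd_nnsfun_approx.
Qed.

Lemma integral_nnsfunM (R : realType) d1 d2 (T1 : measurableType d1)
    (T2 : measurableType d2) (m1 : {measure set T1 -> \bar R}) (Y : T1 -> T2)
    (F : T1 -> R) (phi : {nnsfun T2 >-> R}) :
  measurable_fun [set: T1] Y -> measurable_fun [set: T1] F ->
  (forall x, (0 <= F x)%R) ->
  \int[m1]_x (phi (Y x) * F x)%:E =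
  \sum_(r \in range phi) r%:E * \int[m1]_x (\1_(phi @^-1` [set r]) (Y x) * F x)%:E.
Proof.
move=> mY mF F0.
have mI r : measurable_fun [set: T1]
    (fun x => (\1_(phi @^-1` [set r]) (Y x) * F x)%:E).
  apply/measurable_EFinP; apply: measurable_funM => //.
  have mi : measurable_fun [set: T2] (\1_(phi @^-1` [set r]) : T2 -> R).
    exact: measurable_indic.
  exact: measurableT_comp mi mY.
have r0 r : range phi r -> (0 <= r)%R by move=> [y _ <-]; rewrite fun_ge0.
transitivity (\int[m1]_x \sum_(r \in range phi)
    (r * (\1_(phi @^-1` [set r]) (Y x) * F x))%:E).
  apply: eq_integral => x _; rewrite fimfunE fsumEFin//; congr EFin.
  rewrite !fsbig_finite//= mulr_suml.
  by apply: eq_bigr => r _; rewrite mulrA.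
rewrite ge0_integral_fsum//.
- apply: eq_fsbigr => r /set_mem /r0 rr; rewrite -ge0_integralZl//.
    by move=> x _; rewrite lee_fin mulr_ge0.
- by move=> r; under eq_fun do rewrite EFinM; exact: measurable_funeM.
- move=> r x _; rewrite lee_fin indicE; case: (boolP (_ \in _)) => [|_].
    by rewrite inE => /= <-; rewrite !mulr_ge0// fun_ge0.
  by rewrite mul0r mulr0.
Qed.

(** Both sides are monotone limits over the same simple functions, so agreement on indicators
    suffices. The weight [F] need not factor through [Y]: it can carry a sampling indicator or the
    factors of other entries. *)
Lemma ge0_integral_transfer (R : realType) d1 d2 (T1 : measurableType d1)
    (T2 : measurableType d2) (m1 : {measure set T1 -> \bar R})
    (m2 : {measure set T2 -> \bar R}) (Y : T1 -> T2) (F : T1 -> R)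
    (G : T2 -> R) (phi : T2 -> \bar R) :
  measurable_fun [set: T1] Y -> measurable_fun [set: T1] F ->
  measurable_fun [set: T2] G ->
  (forall x, (0 <= F x)%R) -> (forall y, (0 <= G y)%R) ->
  (forall A, measurable A ->
    \int[m1]_x (\1_A (Y x) * F x)%:E = \int[m2]_y (\1_A y * G y)%:E) ->
  measurable_fun [set: T2] phi -> (forall y, 0 <= phi y) ->
  \int[m1]_x (phi (Y x) * (F x)%:E) = \int[m2]_y (phi y * (G y)%:E).
Proof.
move=> mY mF mG F0 G0 FG mphi phi0.
rewrite (integral_nnsfun_approxM m1 mphi)//.
rewrite (integral_nnsfun_approxM m2 mphi (Y := id))//.
congr (limn _); apply/funext => n.
rewrite (integral_nnsfunM _ _ mY)// (@integral_nnsfunM _ _ _ _ _ m2 id)//.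
by apply: eq_fsbigr => r _; rewrite FG//.
Qed.

End transfer.

Lemma measurable_fprod (R : realType) d (T : measurableType d) (I : finType)
    (Q : pred I) (h : I -> T -> R) :
  (forall i, measurable_fun [set: T] (h i)) ->
  measurable_fun [set: T] (fun x => \prod_(i | Q i) h i x).
Proof.
move=> mh; under eq_fun do rewrite big_mkcond; apply: measurable_prod => i _.
by case: (Q i).
Qed.

(** * Joint law of the sampling pattern and the observations *)

Section independence.
Context (R : realType) dT (T : measurableType dT) (P : probability T R).
Context (I : finType) dY (Ys : measurableType dY).
Variables (mu : {measure set Ys -> \bar R}) (Yv : I -> T -> Ys) (Om : I -> set T).
Variables (f : I -> Ys -> R) (gamma : R).
Hypothesis mOm : forall t, measurable (Om t).
Hypothesis POm : forall t, P (Om t) = gamma%:E.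
Hypothesis mYv : forall t, measurable_fun [set: T] (Yv t).
Hypothesis mf : forall t, measurable_fun [set: Ys] (f t).
Hypothesis f0 : forall t y, 0 <= f t y.
Hypothesis PYv : forall t (A : set Ys), measurable A ->
  P (Yv t @^-1` A) = (\int[mu]_(y in A) (f t y)%:E)%E.
Hypothesis indep : mutually_indep P Yv Om.

Lemma measurable_fun_sampled t : measurable_fun [set: T] (fun w => `[< Om t w >]).
Proof.
apply: (measurable_fun_bool true); rewrite setTI (_ : _ @^-1` _ = Om t)//.
by apply/seteqP; split=> w /= => [/asboolP|?]//; apply/asboolP.
Qed.

Lemma measurable_sampled t (S : set bool) : measurable [set w | `[< Om t w >] \in S].
Proof.
rewrite (_ : [set w | _] = (fun w => `[< Om t w >]) @^-1` S); last first.
  by apply/seteqP; split=> w /=; rewrite inE.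
by rewrite -[X in measurable X]setTI; exact: measurable_fun_sampled.
Qed.

Lemma measurable_sampled_indic t (S : set bool) :
  measurable_fun [set: T] (fun w => (`[< Om t w >] \in S)%:R : R).
Proof.
rewrite (_ : (fun _ => _) = \1_[set w | `[< Om t w >] \in S] :> (T -> R)).
  by apply: measurable_indic; exact: measurable_sampled.
by apply/funext => w; rewrite indicE mem_setE.
Qed.

Lemma integral_setI_density t (A : set Ys) : measurable A ->
  (\int[mu]_y (\1_A y * f t y)%:E = P (Yv t @^-1` A))%E.
Proof.
move=> mA; rewrite PYv// [RHS]integral_mkcond; apply: eq_integral => y _.
by rewrite patchE indicE; case: ifPn => _; rewrite ?mul1r ?mul0r.
Qed.

Lemma prob_sampled_true t : P [set w | `[< Om t w >] \in [set true]] = gamma%:E.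
Proof.
rewrite -(POm t); congr (P _); apply/seteqP; split=> w /=; rewrite inE/=.
  by move=> /asboolP.
by move=> ?; apply/asboolP.
Qed.

Lemma prob_sampled_false t :
  P [set w | `[< Om t w >] \in [set false]] = (1 - gamma)%:E.
Proof.
rewrite EFinB -(POm t) -probability_setC//; congr (P _).
apply/seteqP; split=> w /=; rewrite inE/=; first by move=> /asboolPn.
by move=> ?; apply/asboolPn.
Qed.

(** The joint hypothesis is read on rectangles that are the whole space at every index other than
    [t]. *)
Lemma prob_obs_sampled t (A : set Ys) : measurable A ->
  P (Yv t @^-1` A `&` Om t) = (P (Yv t @^-1` A) * gamma%:E)%E.
Proof.
move=> mA.
pose A' s := if s == t then A else setT.
pose S' s := if s == t then [set true] else setT.
have mA' s : measurable (A' s) by rewrite /A'; case: ifP.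
have := indep S' mA'; rewrite (bigD1 t)//= [X in _ = (_ * X)%E](_ : _ = 1%E); last first.
  apply: big1 => s /negPf st; rewrite /A' /S' st preimage_setT probability_setT mul1e.
  rewrite -[RHS](probability_setT P); congr (P _).
  by apply/seteqP; split=> w //= _; rewrite in_setT.
rewrite mule1 /A' /S' eqxx prob_sampled_true => <-; congr (P _).
apply/seteqP; split=> w /=.
  move=> [Aw Ow] s _; case: eqP => [->|_]; split => //=; last by rewrite in_setT.
  by rewrite inE/=; apply/asboolP.
by move=> /(_ t Logic.I); rewrite eqxx/= inE/= => -[Aw /asboolP].
Qed.

(** On the event that [t] is sampled, [Yv t] has density [gamma * f t]; transfer extends this from
    indicators to [psi]. *)
Lemma integral_sampled t (psi : Ys -> \bar R) :
  measurable_fun [set: Ys] psi -> (forall y, 0 <= psi y)%E ->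
  (\int[P]_w (psi (Yv t w) * (\1_(Om t) w)%:E) =
   gamma%:E * \int[mu]_y (psi y * (f t y)%:E))%E.
Proof.
move=> mpsi psi0.
have g0 : 0 <= gamma by rewrite -lee_fin -(POm t).
rewrite (@ge0_integral_transfer _ _ _ _ _ P mu (Yv t) (\1_(Om t))
  (fun y => gamma * f t y) psi)//.
- rewrite -ge0_integralZl//.
  + by apply: eq_integral => y _; rewrite EFinM muleCA.
  + by apply: emeasurable_funM => //; exact/measurable_EFinP.
  + by move=> y _; rewrite mule_ge0// lee_fin.
- exact: measurable_funM.
- by move=> y; rewrite mulr_ge0.
- move=> A mA.
  transitivity (P (Yv t @^-1` A `&` Om t)).
    rewrite -[X in P X]setIT -integral_indic//; last first.
      apply: measurableI => //.
      by rewrite -[X in measurable X]setTI; exact: mYv.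
    apply: eq_integral => w _; rewrite indicI; congr (_ * _)%:E.
  rewrite prob_obs_sampled// -integral_setI_density// muleC -ge0_integralZl//.
  + by apply: eq_integral => y _; rewrite -EFinM; congr EFin; ring.
  + by apply/measurable_EFinP; apply: measurable_funM.
  + by move=> y _; rewrite lee_fin mulr_ge0.
Qed.

Lemma ae_observed t (N : set Ys) : measurable N ->
  {ae mu, forall y, N y -> f t y = 0} -> {ae P, forall w, ~ N (Yv t w)}.
Proof.
move=> mN N0; exists (Yv t @^-1` N); split.
- by rewrite -[X in measurable X]setTI; exact: mYv.
- rewrite PYv//; apply: (etrans (ge0_ae_eq_integral (g := cst 0%E) _ _ _ _ _ _)) => //.
  + by apply: measurable_funTS; exact/measurable_EFinP.
  + by move=> y _; rewrite lee_fin.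
  + by apply: filterS N0 => y yN /yN ->.
  + exact: integral0.
- by move=> w /= /contrapT.
Qed.

Variables (phi : I -> Ys -> R) (e : I -> R).
Hypothesis mphi : forall t, measurable_fun [set: Ys] (phi t).
Hypothesis phi0 : forall t y, 0 <= phi t y.
Hypothesis phif : forall t, (\int[mu]_y (phi t y * f t y)%:E = (e t)%:E)%E.

Let fac (D : {set I}) (A : I -> set Ys) (S : I -> set bool) t w : R :=
  if t \in D then (if `[< Om t w >] then phi t (Yv t w) else 1)
  else \1_(A t) (Yv t w) * (`[< Om t w >] \in S t)%:R.

(** The mean of [fac]: an index in [D] contributes 1 when unsampled and [phi t] when sampled. *)
Let val (D : {set I}) (A : I -> set Ys) (S : I -> set bool) t : R :=
  if t \in D then 1 - gamma + gamma * e t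
  else fine (P (Yv t @^-1` A t)) * fine (P [set w | `[< Om t w >] \in S t]).

Let fac_ge0 D A S t w : 0 <= fac D A S t w.
Proof. by rewrite /fac; repeat case: ifP => _ //; rewrite mulr_ge0. Qed.

Let measurable_fac D A S t : measurable (A t) ->
  measurable_fun [set: T] (fac D A S t).
Proof.
move=> mA; rewrite /fac; case: (t \in D).
  apply: measurable_fun_ifT => //; first exact: measurable_fun_sampled.
  exact: measurableT_comp.
apply: measurable_funM; last exact: measurable_sampled_indic.
have mi : measurable_fun [set: Ys] (\1_(A t) : Ys -> R) by exact: measurable_indic.
exact: measurableT_comp mi (mYv t).
Qed.

(* The factors outside D are still indicators; enlarging D by one index replaces
   an indicator by a general function of (Y_t, 1_(t in Omega)), so the hypothesis
   on measurable rectangles is the case where D is empty. *)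
Lemma integral_prod_indep_fac (D : {set I}) A S : (forall t, measurable (A t)) ->
  (\int[P]_w (\prod_t fac D A S t w)%:E = (\prod_t val D A S t)%:E)%E.
Proof.
have [n] := ubnP #|D|; elim: n D A S => // n IH D A S Dn mA.
have [->|[t0 t0D]] := set_0Vmem D.
  transitivity (\int[P]_w (\1_(\bigcap_(t in [set: I])
      (Yv t @^-1` A t `&` [set w | `[< Om t w >] \in S t])) w)%:E)%E.
    apply: eq_integral => w _; congr EFin; rewrite indicE.
    have [ww|ww] := pselect (forall t, A t (Yv t w) /\ `[< Om t w >] \in S t).
      rewrite mem_set; last by move=> t _; exact: ww.
      rewrite big1// => t _; have [Aw Sw] := ww t.
      by rewrite /fac inE indicE mem_set// Sw mulr1.
    rewrite memNset; last by move=> ww'; apply: ww => t; exact: ww'.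
    have /existsNP[t /not_andP tw] := ww.
    rewrite (bigD1 t)//= {1}/fac inE indicE.
    case: tw => [tw|/negP/negPf ->]; last by rewrite mulr0 mul0r.
    by rewrite memNset// !mul0r.
  rewrite integral_indic//; last first.
    apply: fin_bigcap_measurable => // t _; apply: measurableI.
      by rewrite -[X in measurable X]setTI; exact: mYv.
    exact: measurable_sampled.
  rewrite setIT; apply: (etrans (indep S mA)); rewrite -prodEFin; apply: eq_bigr => t _.
  rewrite /val inE EFinM !fineK//; apply: fin_num_measure.
    exact: measurable_sampled.
  by rewrite -[X in measurable X]setTI; exact: mYv.
pose D' := D :\ t0.
pose A' B t := if t == t0 then B else A t.
pose S' b t := if t == t0 then [set b] else S t.
pose F w := \prod_(t | t != t0) fac D A S t w.
pose C := \prod_(t | t != t0) val D A S t.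
have F0 w : 0 <= F w by apply: prodr_ge0 => t _; exact: fac_ge0.
have mF : measurable_fun [set: T] F.
  by apply: measurable_fprod => t; exact: measurable_fac.
(* The slot of [t0], freed by shrinking [D], is filled with the rectangle given by [B] and [b]; the
   remaining factors ride along inside [F]. *)
have IHt B b : measurable B -> (\int[P]_w (\1_B (Yv t0 w) *
    ((`[< Om t0 w >] == b)%:R * F w))%:E =
    (fine (P (Yv t0 @^-1` B)) * (if b then gamma else 1 - gamma) * C)%:E)%E.
  move=> mB.
  have := IH D' (A' B) (S' b) _ _.
  rewrite (bigD1 t0)//= {1}/val !inE eqxx/= /A' /S' eqxx.
  rewrite (_ : fine (P [set w | `[< Om t0 w >] \in [set b]]) =
     if b then gamma else 1 - gamma); last first.
    by case: (b); rewrite ?prob_sampled_true ?prob_sampled_false.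
  rewrite (_ : \prod_(t | t != t0) _ = C); last first.
    by apply: eq_bigr => t /negPf tt0; rewrite /val !inE tt0.
  move=> <-.
  - apply: eq_integral => w _; congr EFin.
    rewrite [RHS](bigD1 t0)//= {1}/fac !inE !eqxx/= mulrA; congr (_ * _ * _).
      by rewrite classical_sets.in_set1.
    by apply: eq_bigr => t /negPf tt0; rewrite /fac !inE tt0.
  - by move: Dn; rewrite (cardsD1 t0) t0D.
  - by move=> t; case: ifP.
pose M (b : bool) w : R := (`[< Om t0 w >] == b)%:R * F w.
have mM b : measurable_fun [set: T] (M b).
  apply: measurable_funM => //.
  have := measurable_sampled_indic t0 [set b].
  by under eq_fun do rewrite classical_sets.in_set1.
have M0 b w : 0 <= M b w by rewrite mulr_ge0.
have g0 : 0 <= gamma by rewrite -lee_fin -(POm t0).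
have g1 : gamma <= 1 by rewrite -lee_fin -(POm t0); exact: probability_le1.
have e0 t : 0 <= e t.
  rewrite -lee_fin -phif; apply: integral_ge0 => y _.
  by rewrite lee_fin mulr_ge0.
have C0 : 0 <= C.
  apply: prodr_ge0 => t _; rewrite /val; case: ifP => _.
    by rewrite addr_ge0 ?subr_ge0// mulr_ge0.
  by rewrite mulr_ge0// fine_ge0.
transitivity (\int[P]_w ((M false w)%:E + (phi t0 (Yv t0 w) * M true w)%:E))%E.
  apply: eq_integral => w _; rewrite -EFinD; congr EFin.
  rewrite (bigD1 t0)//= -/(F w) {1}/fac t0D /M.
  by case: ifP => _ /=; rewrite ?mul0r ?mul1r ?mulr0 ?addr0 ?add0r.
rewrite ge0_integralD//; last 4 first.
- by move=> w _; rewrite lee_fin.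
- exact/measurable_EFinP.
- by move=> w _; rewrite lee_fin mulr_ge0.
- by apply/measurable_EFinP; apply: measurable_funM => //; exact: measurableT_comp.
under [X in (_ + X)%E]eq_integral do rewrite EFinM.
(* By [IHt] at [true], [Yv t0] weighted by [M true] has density [gamma * C * f t0], so transfer
   applies to [phi t0]. *)
rewrite (@ge0_integral_transfer _ _ _ _ _ P mu (Yv t0) (M true)
  (fun y => gamma * C * f t0 y) (EFin \o phi t0))//; last 5 first.
- exact: measurable_funM.
- by move=> y; rewrite !mulr_ge0.
- move=> B mB; rewrite IHt//.
  transitivity ((gamma * C)%:E * \int[mu]_y (\1_B y * f t0 y)%:E)%E.
    rewrite integral_setI_density// -[in RHS](fineK (fin_num_measure P _ _)).
      by rewrite -EFinM; congr EFin; ring.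
    by rewrite -[X in measurable X]setTI; exact: mYv.
  rewrite -ge0_integralZl//.
  - by apply: eq_integral => y _; rewrite -EFinM; congr EFin; ring.
  - by apply/measurable_EFinP; apply: measurable_funM.
  - by move=> y _; rewrite lee_fin mulr_ge0.
  - by rewrite lee_fin mulr_ge0.
- exact/measurable_EFinP.
- by move=> y /=; rewrite lee_fin.
have -> : (\int[P]_w (M false w)%:E = ((1 - gamma) * C)%:E)%E.
  have := IHt setT false measurableT; rewrite preimage_setT probability_setT mul1r => <-.
  by apply: eq_integral => w _; rewrite indicT mul1r.
rewrite (_ : (\int[mu]_y _)%E = (gamma * C * e t0)%:E).
  rewrite -EFinD; congr EFin; rewrite [RHS](bigD1 t0)//= -/C /val t0D; ring.
rewrite EFinM -phif -ge0_integralZl//.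
- by apply: eq_integral => y _; rewrite -!EFinM; congr EFin; ring.
- by apply/measurable_EFinP; apply: measurable_funM.
- by move=> y _; rewrite lee_fin mulr_ge0.
- by rewrite lee_fin mulr_ge0.
Qed.

Lemma integral_prod_sampled :
  (\int[P]_w (\prod_t if `[< Om t w >] then phi t (Yv t w) else 1)%:E =
   (\prod_t (1 - gamma + gamma * e t))%:E)%E.
Proof.
have := @integral_prod_indep_fac [set: I]%SET (fun=> setT) (fun=> setT)
  (fun=> measurableT).
rewrite (eq_bigr (fun t => 1 - gamma + gamma * e t)); last first.
  by move=> t _; rewrite /val inE.
move=> <-; apply: eq_integral => w _; congr EFin.
by apply: eq_bigr => t _; rewrite /fac inE.
Qed.

End independence.

(** * Comparison of integrals and convexity of the exponential *)

Lemma ae_le_integral (R : realType) d (T : measurableType d)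
    (mu : {measure set T -> \bar R}) (f g : T -> \bar R) :
  mu.-integrable [set: T] f -> mu.-integrable [set: T] g ->
  {ae mu, forall x, (f x <= g x)%E} -> (\int[mu]_x f x <= \int[mu]_x g x)%E.
Proof.
move=> fi gi fg; have mf := measurable_int mu fi; have mg := measurable_int mu gi.
rewrite integralE [leRHS]integralE leeB//; apply: ae_ge0_le_integral => //;
  try exact: measurable_funepos; try exact: measurable_funeneg;
  apply: filterS fg => x fgx _.
- by rewrite !funeposE ge_max !le_max fgx lexx orbT.
- by rewrite !funenegE ge_max !le_max leeN2 fgx lexx orbT.
Qed.

(** The tangent to [expR] at [t * x] is evaluated at [x] and at 0 and averaged with weights [t] and
    [1 - t]; the linear terms cancel. *)
Lemma expR_convex01 (R : realType) (t x : R) : 0 <= t <= 1 ->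
  expR (t * x) <= 1 - t + t * expR x.
Proof.
move=> /andP[t0 t1].
have h1 : expR (t * x) * (1 + (1 - t) * x) <= expR x.
  have -> : expR x = expR (t * x) * expR ((1 - t) * x).
    by rewrite -expRD; congr expR; ring.
  by rewrite ler_wpM2l ?expR_ge0// expR_ge1Dx.
have h2 : expR (t * x) * (1 - t * x) <= 1.
  apply: (@le_trans _ _ (expR (t * x) * expR (- (t * x)))); last first.
    by rewrite -expRD subrr expR0.
  by rewrite ler_wpM2l ?expR_ge0// expR_ge1Dx.
have t1' : 0 <= 1 - t by rewrite subr_ge0.
have := lerD (ler_wpM2l t0 h1) (ler_wpM2l t1' h2).
by move: (expR (t * x)) (expR x) => a b; nra.
Qed.

(** * Hellinger affinity and KL divergence of two densities *)

Section single_letter.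
Context (R : realType) dY (Ys : measurableType dY) (mu : {measure set Ys -> \bar R}).
Variables (f q : Ys -> R) (kappa : R).
Hypothesis mf : measurable_fun [set: Ys] f.
Hypothesis mq : measurable_fun [set: Ys] q.
Hypothesis f0 : forall y, 0 <= f y.
Hypothesis q0 : forall y, 0 <= q y.
Hypothesis f1 : (\int[mu]_y (f y)%:E = 1)%E.
Hypothesis q1 : (\int[mu]_y (q y)%:E = 1)%E.
Hypothesis KLk : (KL mu f q <= kappa%:E)%E.

Let ell y : R := ln (f y / q y).

Lemma measurable_logratio : measurable_fun [set: Ys] ell.
Proof.
apply: (measurableT_comp (f := @ln R)); first exact: measurable_ln.
apply: measurable_funM => //.
under eq_fun do rewrite -powR_inv1//.
exact: (measurableT_comp (f := @powR R ^~ (-1))).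
Qed.

Lemma KL_ac : {ae mu, forall y, q y = 0 -> f y = 0}.
Proof. by move: KLk; rewrite /KL; case: asboolP. Qed.

Lemma KL_integral : KL mu f q = (\int[mu]_y (f y * ell y)%:E)%E.
Proof. by move: KLk; rewrite /KL; case: asboolP. Qed.

Let mfell : measurable_fun [set: Ys] (fun y => f y * ell y).
Proof. by apply: measurable_funM => //; exact: measurable_logratio. Qed.

(** This is [ln u >= 1 - 1 / u] at [u = f / q], multiplied by [f]. It bounds the negative part of
    the KL integrand by [q]. *)
Let ell_ge y : (q y = 0 -> f y = 0) -> f y - q y <= f y * ell y.
Proof.
rewrite /ell; have := q0 y; rewrite le_eqVlt => /predU1P[<- /(_ erefl) ->|qy _].
  by rewrite subr0 mul0r.
have := f0 y; rewrite le_eqVlt => /predU1P[<-|fy].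
  by rewrite mul0r sub0r oppr_le0 ltW.
have fq : 0 < f y / q y by rewrite divr_gt0.
have := expR_ge1Dx (- ln (f y / q y)); rewrite expRN lnK// invf_div => h.
have := ler_wpM2l (ltW fy) h.
have -> : f y * (q y / f y) = q y by rewrite mulrCA divff ?mulr1// gt_eqF.
by rewrite mulrDr mulr1 mulrN => h2; lra.
Qed.

(** The negative part integrates to at most 1 by [ell_ge]; the difference of the parts is at most
    [kappa], so the positive part is finite too. *)
Lemma integrable_KL : mu.-integrable [set: Ys] (fun y => (f y * ell y)%:E).
Proof.
have mE : measurable_fun [set: Ys] (fun y => (f y * ell y)%:E) by exact/measurable_EFinP.
have nlt : (\int[mu]_y ((fun y => (f y * ell y)%:E)^\- y) < +oo)%E.
  apply: (@le_lt_trans _ _ (\int[mu]_y (q y)%:E)%E); last by rewrite q1 ltry.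
  apply: ae_ge0_le_integral => //.
  - exact: measurable_funeneg.
  - by move=> y _; rewrite lee_fin.
  - exact/measurable_EFinP.
  apply: filterS KL_ac => y /ell_ge h _.
  rewrite funenegE -EFinN -EFin_max lee_fin ge_max q0 andbT.
  by have := f0 y; lra.
have plt : (\int[mu]_y ((fun y => (f y * ell y)%:E)^\+ y) < +oo)%E.
  move: KLk; rewrite KL_integral integralE; move: nlt.
  have : (0 <= \int[mu]_y ((fun y => (f y * ell y)%:E)^\- y))%E.
    by apply: integral_ge0.
  case: (\int[mu]_y _^\- y)%E => // M M0 _.
  by rewrite leeBlDr// => /le_lt_trans; apply; rewrite -EFinD ltry.
rewrite (funeposneg (fun y => (f y * ell y)%:E)); apply: integrableB => //.
- apply/integrableP; split; first exact: measurable_funepos.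
  by under eq_integral do rewrite gee0_abs//.
- apply/integrableP; split; first exact: measurable_funeneg.
  by under eq_integral do rewrite gee0_abs//.
Qed.

Lemma integrable_density : mu.-integrable [set: Ys] (EFin \o f).
Proof.
apply/integrableP; split; first exact/measurable_EFinP.
by under eq_integral do rewrite /= ger0_norm//; rewrite f1 ltry.
Qed.

Let msqrt : measurable_fun [set: Ys] (fun y => Num.sqrt (f y * q y)).
Proof.
under eq_fun do rewrite -powR12_sqrt ?mulr_ge0//.
by apply: (measurableT_comp (f := @powR R ^~ (2^-1))) => //; exact: measurable_funM.
Qed.

(** Arithmetic-geometric mean inequality. It ensures that [fine] in [hell] does not collapse an
    infinite value. *)
Let hell_le : (\int[mu]_y (Num.sqrt (f y * q y))%:E <= 1)%E.
Proof.
apply: (@le_trans _ _ (\int[mu]_y (2^-1 * (f y + q y))%:E)%E).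
  apply: ge0_le_integral => //.
  - exact/measurable_EFinP.
  - by apply/measurable_EFinP; apply: measurable_funM => //; exact: measurable_funD.
  move=> y _; rewrite lee_fin -[leRHS]ger0_norm; last by rewrite mulr_ge0// addr_ge0.
  rewrite -sqrtr_sqr ler_wsqrtr//.
  by have := sqr_ge0 (f y - q y); rewrite !expr2; lra.
under eq_integral do rewrite EFinM EFinD.
rewrite ge0_integralZl//=.
- rewrite ge0_integralD//.
  + by rewrite f1 q1 -EFinD -EFinM lee_fin; lra.
  + by move=> y _; rewrite lee_fin.
  + exact/measurable_EFinP.
  + by move=> y _; rewrite lee_fin.
  + exact/measurable_EFinP.
- by apply/measurable_EFinP; exact: measurable_funD.
- by move=> y _; rewrite lee_fin addr_ge0.
Qed.

Lemma integral_hell : (\int[mu]_y (Num.sqrt (f y * q y))%:E = (hell mu f q)%:E)%E.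
Proof.
rewrite /hell fineK// ge0_fin_numE; last by apply: integral_ge0 => y _; rewrite lee_fin.
by rewrite (le_lt_trans hell_le)// ltry.
Qed.

Lemma hell_le1 : hell mu f q <= 1.
Proof. by rewrite -lee_fin -integral_hell. Qed.

(* This is ln v <= v - 1 at v = sqrt (q / f) / c; the choice c = H(f, q) below
   gives Jensen's inequality without assuming H(f, q) > 0 beforehand. *)
Lemma logratio_tangent (c : R) y : 0 < c -> (q y = 0 -> f y = 0) ->
  - 2 / c * Num.sqrt (f y * q y) + 2 * (1 - ln c) * f y <= f y * ell y.
Proof.
move=> c0 qf; have := f0 y; rewrite le_eqVlt => /predU1P[<-|fy].
  by rewrite !mul0r sqrtr0 !mulr0 addr0.
have qy : 0 < q y.
  by rewrite lt_neqAle q0 andbT eq_sym; apply/eqP => /qf fy0; rewrite fy0 ltxx in fy.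
have fq : 0 < f y * q y by rewrite mulr_gt0.
rewrite /ell; set s := Num.sqrt _.
have s0 : 0 < s by rewrite sqrtr_gt0.
have sE : s ^+ 2 = f y * q y by rewrite sqr_sqrtr// ltW.
have v0 : 0 < s / (f y * c) by rewrite divr_gt0// mulr_gt0.
have := expR_ge1Dx (ln (s / (f y * c))); rewrite lnK// => h.
have E : ln (f y / q y) = - 2 * (ln (s / (f y * c)) + ln c).
  rewrite -lnM ?posrE// mulNr mulr_natl -lnXn; last by rewrite mulr_gt0.
  rewrite -lnV ?posrE ?exprn_gt0 ?mulr_gt0 ?invr_gt0 ?mulr_gt0//; congr (ln _).
  rewrite !exprMn sE exprVn !exprMn; field.
  by rewrite !gt_eqF.
have := ler_wpM2l (ltW fy) h.
have -> : f y * (s / (f y * c)) = s / c by field; rewrite !gt_eqF.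
rewrite E mulrDr mulr1 => h2.
have -> : - 2 / c * s = - 2 * (s / c) by field; rewrite gt_eqF.
by move: (ln (s / _)) h2 => l h2; move: (s / c) h2 => w h2; lra.
Qed.

(** The pointwise bound, integrated. The free [c] serves twice: one choice excludes zero affinity,
    and the maximizer [c = H] gives [-2 ln H]. *)
Lemma hell_tangent (c : R) : 0 < c ->
  ((- 2 / c * hell mu f q + 2 * (1 - ln c))%:E <= KL mu f q)%E.
Proof.
move=> c0; rewrite KL_integral.
have iS : mu.-integrable [set: Ys] (fun y => (Num.sqrt (f y * q y))%:E).
  apply/integrableP; split; first exact/measurable_EFinP.
  under eq_integral do rewrite /= ger0_norm//.
  by rewrite integral_hell ltry.
apply: (@le_trans _ _ (\int[mu]_y ((- 2 / c)%:E * (Num.sqrt (f y * q y))%:E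
    + (2 * (1 - ln c))%:E * (f y)%:E))%E).
  rewrite integralD//; [|exact: integrableZl|exact: integrableZl integrable_density].
  rewrite !integralZl//; last exact: integrable_density.
  by rewrite integral_hell f1 mule1 -EFinM -EFinD.
apply: ae_le_integral; last first.
- by apply: filterS KL_ac => y /(logratio_tangent c0); rewrite -!EFinM -EFinD lee_fin.
- exact: integrable_KL.
- by apply: integrableD => //; apply: integrableZl => //; exact: integrable_density.
Qed.

Lemma hell_ge0 : 0 <= hell mu f q.
Proof. by rewrite -lee_fin -integral_hell; apply: integral_ge0 => y _; rewrite lee_fin. Qed.

Lemma hell_gt0 : 0 < hell mu f q.
Proof.
rewrite lt_neqAle hell_ge0 andbT eq_sym; apply/eqP => H0.
(* With affinity 0, the tangent bound at this [c] reads [2 + kappa <= kappa]. *)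
have := le_trans (hell_tangent (expR_gt0 (- kappa / 2))) KLk.
by rewrite H0 mulr0 add0r expRK lee_fin => ?; lra.
Qed.

Lemma le_hell_KL : ((-2 * ln (hell mu f q))%:E <= KL mu f q)%E.
Proof.
apply: le_trans (hell_tangent hell_gt0); rewrite lee_fin.
by rewrite mulfVK ?gt_eqF ?hell_gt0//; lra.
Qed.

Lemma KL_posneg : exists P N : R,
  [/\ (\int[mu]_y ((Num.max (ell y) 0)%:E * (f y)%:E) = P%:E)%E,
      (\int[mu]_y ((Num.max (- ell y) 0)%:E * (f y)%:E) = N%:E)%E
    & KL mu f q = (P - N)%:E].
Proof.
have fp := integrable_pos_fin_num measurableT integrable_KL.
have fn := integrable_neg_fin_num measurableT integrable_KL.
pose g y := (f y * ell y)%:E.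
exists (fine (\int[mu]_y g^\+ y)%E), (fine (\int[mu]_y g^\- y)%E).
split; last by rewrite KL_integral integralE EFinB !fineK.
- rewrite fineK//; apply: eq_integral => y _.
  by rewrite funeposE -EFin_max -EFinM maxr_pMl// mul0r mulrC.
- rewrite fineK//; apply: eq_integral => y _.
  by rewrite funenegE -EFinN -EFin_max -EFinM maxr_pMl// mul0r mulNr mulrC.
Qed.

(** Jensen for the concave power [v ^ theta] at [v = sqrt (q / f)], whose mean under [f] is [H]: the
    tangent line at [v = H] is integrated against [f]. *)
Lemma integral_ratio_power (theta : R) : 0 <= theta <= 1 ->
  (\int[mu]_y (expR (- (theta / 2 * ell y)) * f y)%:E <=
    (expR (theta * ln (hell mu f q)))%:E)%E.
Proof.
move=> /andP[t0 t1]; set H := hell mu f q; have H0 : 0 < H by exact: hell_gt0.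
set Ht := expR (theta * ln H).
have Ht0 : 0 < Ht by exact: expR_gt0.
have c0 : 0 <= Ht * (theta / H) by rewrite mulr_ge0 ?(ltW Ht0)// divr_ge0// ltW.
have c1 : 0 <= Ht * (1 - theta) by rewrite mulr_ge0 ?(ltW Ht0)// subr_ge0.
have mA : measurable_fun [set: Ys]
    (fun y => (Ht * (theta / H))%:E * (Num.sqrt (f y * q y))%:E)%E.
  by apply: measurable_funeM; exact/measurable_EFinP.
have mB : measurable_fun [set: Ys] (fun y => (Ht * (1 - theta))%:E * (f y)%:E)%E.
  by apply: measurable_funeM; exact/measurable_EFinP.
apply: (@le_trans _ _ (\int[mu]_y ((Ht * (theta / H))%:E * (Num.sqrt (f y * q y))%:E
    + (Ht * (1 - theta))%:E * (f y)%:E))%E); last first.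
  rewrite ge0_integralD//.
  - rewrite !ge0_integralZl//.
    + rewrite integral_hell f1 -!EFinM -EFinD lee_fin -/H le_eqVlt; apply/orP; left.
      by apply/eqP; field; rewrite gt_eqF.
    + exact/measurable_EFinP.
    + by move=> y _; rewrite lee_fin.
    + exact/measurable_EFinP.
  - by move=> y _; rewrite -EFinM lee_fin mulr_ge0.
  - by move=> y _; rewrite -EFinM lee_fin mulr_ge0.
apply: ae_ge0_le_integral => //.
- by move=> y _; rewrite lee_fin mulr_ge0 ?expR_ge0.
- apply/measurable_EFinP; apply: measurable_funM => //.
  apply: (measurableT_comp (f := @expR R)) => //; apply: measurable_funN.
  by apply: measurable_funM => //; exact: measurable_logratio.
- by move=> y _; rewrite -!EFinM -EFinD lee_fin addr_ge0// mulr_ge0.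
- exact: emeasurable_funD.
apply: filterS KL_ac => y qf _; rewrite -!EFinM -EFinD lee_fin.
have := f0 y; rewrite le_eqVlt => /predU1P[<-|fy].
  by rewrite !(mul0r, sqrtr0, mulr0) addr0.
have qy : 0 < q y.
  by rewrite lt_neqAle q0 andbT eq_sym; apply/eqP => /qf fy0; rewrite fy0 ltxx in fy.
have sE : Num.sqrt (f y * q y) = f y * expR (- (ell y / 2)).
  rewrite -[RHS]ger0_norm ?mulr_ge0 ?expR_ge0// -sqrtr_sqr; congr Num.sqrt.
  rewrite exprMn -expRM_natl.
  have -> : 2%:R * - (ell y / 2) = - ell y by field.
  rewrite /ell expRN lnK ?posrE ?divr_gt0//; field.
  by rewrite !gt_eqF.
rewrite sE; have t01 : 0 <= theta <= 1 by rewrite t0.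
(* With [ln v = - ell / 2], this is the tangent bound for the power, divided by [H ^ theta]. *)
have := expR_convex01 (- (ell y / 2) - ln H) t01.
rewrite (_ : theta * _ = - (theta / 2 * ell y) - theta * ln H); last by field.
rewrite [X in X <= _]expRB -/Ht [X in _ + _ * X]expRB lnK// => h.
have := ler_wpM2l (mulr_ge0 (ltW Ht0) (ltW fy)) h.
move: (expR (- (ell y / 2))) => u.
move: (expR _) => v; rewrite (_ : Ht * f y * (v / Ht) = v * f y); last first.
  by field; rewrite gt_eqF.
move=> /le_trans; apply; rewrite le_eqVlt; apply/orP; left; apply/eqP; field.
by rewrite gt_eqF.
Qed.

End single_letter.

(** From [expR (- x) <= 1 / (1 + x) <= 1 - x / (1 + y)]. The uniform bound [y] makes the exponent
    linear in [x], so that it can be summed over entries. *)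
Lemma bernoulli_mix_le (R : realType) (g x y : R) : 0 <= g -> 0 <= x <= y ->
  1 - g + g * expR (- x) <= expR (- (g * x / (1 + y))).
Proof.
move=> g0 /andP[x0 xy]; have y1 : 0 < 1 + y by rewrite ltr_wpDr// (le_trans x0).
have x1 : 0 < 1 + x by rewrite ltr_wpDr.
apply: (@le_trans _ _ (1 - g * x / (1 + y))); last exact: expR_ge1Dx.
have h1 : expR (- x) <= 1 / (1 + x).
  by rewrite expRN div1r lef_pV2 ?posrE ?expR_gt0// expR_ge1Dx.
have h2 : 1 / (1 + x) <= 1 - x / (1 + y).
  rewrite -subr_ge0 (_ : _ - _ = x * (y - x) / ((1 + x) * (1 + y))).
    by rewrite divr_ge0// mulr_ge0 ?subr_ge0// ltW.
  by field; rewrite !gt_eqF.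
have := ler_wpM2l g0 (le_trans h1 h2).
by rewrite mulrBr mulr1 mulrA; lra.
Qed.

(** * Oracle inequality for a penalized estimator over a finite family *)

Section oracle.
Context (R : realType) dT (T : measurableType dT) (P : probability T R).
Context (I K : finType) dY (Ys : measurableType dY).
Variables (mu : {measure set Ys -> \bar R}) (Yv : I -> T -> Ys) (Om : I -> set T).
Variables (f : I -> Ys -> R) (gamma : R).
Hypothesis mOm : forall t, measurable (Om t).
Hypothesis POm : forall t, P (Om t) = gamma%:E.
Hypothesis gamma01 : 0 <= gamma <= 1.
Hypothesis mYv : forall t, measurable_fun [set: T] (Yv t).
Hypothesis mf : forall t, measurable_fun [set: Ys] (f t).
Hypothesis f0 : forall t y, 0 <= f t y.
Hypothesis f1 : forall t, (\int[mu]_y (f t y)%:E = 1)%E.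
Hypothesis PYv : forall t (A : set Ys), measurable A ->
  P (Yv t @^-1` A) = (\int[mu]_(y in A) (f t y)%:E)%E.
Hypothesis indep : mutually_indep P Yv Om.
Variables (q : K -> I -> Ys -> R) (kappa : R).
Hypothesis mq : forall k t, measurable_fun [set: Ys] (q k t).
Hypothesis q0 : forall k t y, 0 <= q k t y.
Hypothesis q1 : forall k t, (\int[mu]_y (q k t y)%:E = 1)%E.
Hypothesis KLk : forall k t, (KL mu (f t) (q k t) <= kappa%:E)%E.
Hypothesis kappa0 : 0 <= kappa.
Variables (pen : K -> R) (xi : R).
Hypothesis pen0 : forall k, 0 <= pen k.
Hypothesis kraft : \sum_k expR (- pen k) <= 1.
Hypothesis xige : 2 * (1 + 2 * kappa / 3) <= xi.

(* The largest exponent with 2 / theta <= xi for all admissible xi; it also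
   yields 1 + theta * kappa / 2 <= 7 / 4. *)
Let theta := (1 + 2 * kappa / 3)^-1.
Let th2 := theta / 2.
Let h k t := - 2 * ln (hell mu (f t) (q k t)).
Let ell k t y := ln (f t y / q k t y).
Let a := gamma * th2 / (1 + th2 * kappa).

Let den0 : 0 < 1 + 2 * kappa / 3.
Proof. by have := kappa0; lra. Qed.

Let theta01 : 0 <= theta <= 1.
Proof.
rewrite /theta invr_ge0 (ltW den0)/= invf_le1//.
by have := kappa0; lra.
Qed.

Let theta_gt0 : 0 < theta. Proof. by rewrite invr_gt0. Qed.
Let th2_gt0 : 0 < th2. Proof. by rewrite divr_gt0. Qed.

Lemma hell_rate_bounds k t : 0 <= h k t <= kappa.
Proof.
apply/andP; split; last first.
  by rewrite -lee_fin; apply: le_trans (KLk k t); apply: le_hell_KL (KLk k t).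
rewrite /h mulNr oppr_ge0 pmulr_rle0//; apply: ln_le0.
exact: hell_le1.
Qed.

Let mell k t : measurable_fun [set: Ys] (ell k t).
Proof. exact: measurable_logratio. Qed.

(** The product of [(q / f) ^ th2] over sampled entries, written through [expR] so that it stays
    positive where a density vanishes. *)
Let W k w := \prod_t if `[< Om t w >] then expR (- (th2 * ell k t (Yv t w))) else 1.
Let Z k w := expR (a * (\sum_t h k t) - pen k) * W k w.

(** Independence turns the mean of [W k] into a product whose factors are at most
    [expR (- (a * h k t))]; this cancels the tilt and leaves the penalty. *)
Lemma integral_tilted_lr k : (\int[P]_w (Z k w)%:E <= (expR (- pen k))%:E)%E.
Proof.
pose phi t y := expR (- (th2 * ell k t y)).
have mphi t : measurable_fun [set: Ys] (phi t).
  apply: (measurableT_comp (f := @expR R)) => //; apply: measurable_funN.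
  exact: measurable_funM.
have phi0 t y : 0 <= phi t y by exact: expR_ge0.
pose e t := fine (\int[mu]_y (phi t y * f t y)%:E)%E.
have phif_le t : (\int[mu]_y (phi t y * f t y)%:E <= (expR (- (th2 * h k t)))%:E)%E.
  rewrite (_ : - (th2 * h k t) = theta * ln (hell mu (f t) (q k t))).
    exact: integral_ratio_power (KLk k t) _ theta01.
  by rewrite /th2 /h; field.
have phif t : (\int[mu]_y (phi t y * f t y)%:E = (e t)%:E)%E.
  rewrite /e fineK// ge0_fin_numE; first by rewrite (le_lt_trans (phif_le t))// ltry.
  by apply: integral_ge0 => y _; rewrite lee_fin mulr_ge0.
have e0 t : 0 <= e t.
  by rewrite -lee_fin -phif; apply: integral_ge0 => y _; rewrite lee_fin mulr_ge0.
have ele t : e t <= expR (- (th2 * h k t)) by rewrite -lee_fin -phif.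
have [g0 g1] := andP gamma01.
under eq_integral do rewrite EFinM.
have mW : measurable_fun [set: T] (W k).
  apply: measurable_fprod => t; apply: measurable_fun_ifT => //.
    exact: measurable_fun_sampled.
  exact: measurableT_comp (mphi t) (mYv t).
have W0 w : 0 <= W k w.
  by apply: prodr_ge0 => t _; case: ifP => // _; exact: expR_ge0.
rewrite ge0_integralZl//; last 2 first.
- exact/measurable_EFinP.
- by move=> w _; rewrite lee_fin.
rewrite (integral_prod_sampled mOm POm mYv mf f0 PYv indep mphi phi0 phif).
rewrite -EFinM lee_fin addrC expRD -[leRHS]mulr1 -mulrA ler_wpM2l ?expR_ge0//.
rewrite -[leRHS](expRxMexpNx_1 (a * \sum_t h k t)) ler_wpM2l ?expR_ge0//.
rewrite mulr_sumr -sumrN expR_sum; apply: ler_prod => t _; apply/andP; split.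
  by rewrite addr_ge0 ?subr_ge0// mulr_ge0.
have [h0 hk] := andP (hell_rate_bounds k t).
apply: (@le_trans _ _ (1 - gamma + gamma * expR (- (th2 * h k t)))).
  by rewrite lerD2l ler_wpM2l.
rewrite (_ : a * h k t = gamma * (th2 * h k t) / (1 + th2 * kappa)); last first.
  by rewrite /a; ring.
by apply: bernoulli_mix_le => //; rewrite mulr_ge0 ?(ltW th2_gt0)//= ler_wpM2l// ltW.
Qed.

Variable khat : T -> K.
Hypothesis mkhat : forall k, measurable [set w | khat w = k].
Hypothesis khat_opt : forall k w,
  (\sum_(t | `[< Om t w >]) mlog (q (khat w) t (Yv t w)) + (xi * pen (khat w))%:E
   <= \sum_(t | `[< Om t w >]) mlog (q k t (Yv t w)) + (xi * pen k)%:E)%E.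

(** Almost surely every [mlog] is then finite, and optimality of [khat] is an inequality between
    reals. Absolute continuity makes [f] vanish almost everywhere on the exceptional set. *)
Lemma ae_positive_lik : {ae P, forall w, forall k t,
  0 < q k t (Yv t w) /\ 0 < f t (Yv t w)}.
Proof.
apply: filter_forall => k; apply: filter_forall => t.
have mN : measurable [set y | q k t y = 0 \/ f t y = 0].
  rewrite (_ : [set y | _] = (q k t @^-1` [set 0]) `|` (f t @^-1` [set 0]))//.
  by apply: measurableU; rewrite -[X in measurable X]setTI;
    [exact: mq|exact: mf].
have N0 : {ae mu, forall y, [set y | q k t y = 0 \/ f t y = 0] y -> f t y = 0}.
  by apply: filterS (KL_ac (KLk k t)) => y h0 [/h0|].
apply: filterS (ae_observed mYv mf f0 PYv mN N0) => w /= /not_orP[/eqP h1 /eqP h2].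
by rewrite !lt_neqAle q0 f0 eq_sym h1 eq_sym h2.
Qed.

Let pos k t y := Num.max (ell k t y) 0.
Let neg k t y := Num.max (- ell k t y) 0.

(* Positive and negative parts are kept on opposite sides so that every
   integrand below is nonnegative. *)
Lemma oracle_pointwise k : {ae P, forall w,
  a * (\sum_t h (khat w) t) + (1 + th2 * \sum_t neg k t (Yv t w) * \1_(Om t) w) <=
  \sum_k' Z k' w + (th2 * (xi * pen k) + th2 * \sum_t pos k t (Yv t w) * \1_(Om t) w)}.
Proof.
apply: filterS ae_positive_lik => w qf; set k' := khat w.
(* The [ln f] terms do not depend on the candidate, so they cancel when two criteria are
   compared. *)
have mlogE j : (\sum_(t | `[< Om t w >]) mlog (q j t (Yv t w)) =
    (\sum_(t | `[< Om t w >]) (ell j t (Yv t w) - ln (f t (Yv t w))))%:E)%E.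
  rewrite -sumEFin; apply: eq_bigr => t _; have [qp fp] := qf j t.
  by rewrite /mlog qp /ell ln_div//; congr EFin; ring.
have := khat_opt k w; rewrite !mlogE -!EFinD lee_fin -/k' !sumrB.
set Lf := \sum_(t | _) ln (f t (Yv t w)).
set Lk := \sum_(t | _) ell k t (Yv t w).
set Lk' := \sum_(t | _) ell k' t (Yv t w) => opt.
have indE (F : I -> R) : \sum_t F t * \1_(Om t) w = \sum_(t | `[< Om t w >]) F t.
  rewrite [RHS]big_mkcond; apply: eq_bigr => t _; rewrite indicE.
  rewrite (_ : (w \in Om t) = `[< Om t w >]); last by apply/idP/asboolP; rewrite inE.
  by case: ifP => _; rewrite ?mulr1 ?mulr0.
rewrite !indE.
have LkE : Lk = \sum_(t | `[< Om t w >]) pos k t (Yv t w)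
    - \sum_(t | `[< Om t w >]) neg k t (Yv t w).
  rewrite -sumrB; apply: eq_bigr => t _; rewrite /pos /neg.
  by rewrite maxEle [in RHS]maxEle oppr_le0; case: (leP 0 _) => ?; case: ifP; lra.
(* Only the selected term of the sum is kept, and [1 + x <= expR x] is applied to its exponent. *)
have Zk' : 1 + a * (\sum_t h k' t) - pen k' - th2 * Lk' <= \sum_k Z k w.
  have Z0 j : 0 <= Z j w.
    rewrite mulr_ge0 ?expR_ge0//; apply: prodr_ge0 => t _.
    by case: ifP => // _; exact: expR_ge0.
  rewrite (bigD1 k')//=; apply: ler_wpDr; first by apply: sumr_ge0 => j _; exact: Z0.
  rewrite /Z /W -big_mkcond/= -expR_sum -expRD.
  rewrite -addrA -addrA; apply: le_trans (expR_ge1Dx _); rewrite lerD2l.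
  by rewrite addrA sumrN /Lk' [th2 * _]mulr_sumr.
(* The lower bound on [xi] enters here, as [th2 * xi >= 1]. *)
have pk : pen k' <= th2 * (xi * pen k').
  rewrite mulrA ler_peMl//.
  have -> : 1 = th2 * (2 * (1 + 2 * kappa / 3)).
    by rewrite /th2 /theta; field; rewrite gt_eqF// ; have := den0; lra.
  by rewrite ler_wpM2l// ltW.
have opt' := ler_wpM2l (ltW th2_gt0) opt.
move: opt' Zk'; rewrite LkE !mulrDr !mulrN; lra.
Qed.

Let integral_sum_sampled (F : I -> Ys -> R) (V : I -> R) c : 0 <= c ->
  (forall t, measurable_fun [set: Ys] (F t)) -> (forall t y, 0 <= F t y) ->
  (forall t, (\int[mu]_y ((F t y)%:E * (f t y)%:E) = (V t)%:E)%E) ->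
  (\int[P]_w (c + th2 * \sum_t F t (Yv t w) * \1_(Om t) w)%:E =
   (c + th2 * (gamma * \sum_t V t))%:E)%E.
Proof.
move=> c0 mF F0 FV.
have mFt t : measurable_fun [set: T] (fun w => (F t (Yv t w) * \1_(Om t) w)%:E).
  apply/measurable_EFinP; apply: measurable_funM; first exact: measurableT_comp.
  exact: measurable_indic.
have Ft0 t w : (0 <= (F t (Yv t w) * \1_(Om t) w)%:E)%E.
  by rewrite lee_fin mulr_ge0.
under eq_integral do rewrite EFinD EFinM -sumEFin.
have mS : measurable_fun [set: T]
    (fun w => (\sum_t (F t (Yv t w) * \1_(Om t) w)%:E)%E).
  exact: emeasurable_sum.
have S0 w : (0 <= \sum_t (F t (Yv t w) * \1_(Om t) w)%:E)%E by apply: sume_ge0.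
rewrite ge0_integralD//; last 2 first.
- by move=> w _; rewrite mule_ge0// lee_fin ltW.
- exact: measurable_funeM.
have -> : (\int[P]_w c%:E = c%:E)%E.
  by apply: (etrans (integral_cst P measurableT c%:E)); rewrite (_ : _ setT = 1%E) ?mule1//; exact: probability_setT.
rewrite ge0_integralZl//; last by rewrite lee_fin ltW.
rewrite ge0_integral_sum// EFinD [in RHS]EFinM; congr (_ + _ * _)%E.
rewrite [in RHS]EFinM -sumEFin ge0_sume_distrr; last first.
  move=> t _; rewrite -FV; apply: integral_ge0 => y _.
  by rewrite mule_ge0// lee_fin.
apply: eq_bigr => t _; rewrite -FV.
under eq_integral do rewrite EFinM.
rewrite (integral_sampled mOm POm mYv mf f0 PYv indep t (psi := EFin \o F t))//.
- exact/measurable_EFinP.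
- by move=> y /=; rewrite lee_fin.
Qed.

Lemma oracle_inequality k :
  (gamma%:E * \int[P]_w (\sum_t h (khat w) t)%:E <=
   (7 / 4)%:E * (gamma%:E * (\sum_t KL mu (f t) (q k t)) + (xi * pen k)%:E))%E.
Proof.
have /choice[V HV] : forall t, exists V : R * R,
    [/\ (\int[mu]_y ((pos k t y)%:E * (f t y)%:E) = V.1%:E)%E,
      (\int[mu]_y ((neg k t y)%:E * (f t y)%:E) = V.2%:E)%E
    & KL mu (f t) (q k t) = (V.1 - V.2)%:E].
  by move=> t; have [p [n ?]] := KL_posneg (mf t) (mq k t) (f0 t) (q0 k t) (q1 k t) (KLk k t);
     exists (p, n).
have mpos t : measurable_fun [set: Ys] (pos k t) by exact: measurable_maxr.
have mneg t : measurable_fun [set: Ys] (neg k t).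
  by apply: measurable_maxr => //; exact: measurable_funN.
have pos0 t y : 0 <= pos k t y by rewrite le_max lexx orbT.
have neg0 t y : 0 <= neg k t y by rewrite le_max lexx orbT.
have [g0 g1] := andP gamma01.
have tk0 : 0 <= th2 * kappa by rewrite mulr_ge0// ltW.
have a0 : 0 <= a by rewrite divr_ge0 ?addr_ge0// mulr_ge0// ltW.
have xi0 : 0 <= xi by apply: le_trans xige; rewrite mulr_ge0// ltW.
have H0 j : 0 <= \sum_t h j t.
  by apply: sumr_ge0 => t _; have /andP[] := hell_rate_bounds j t.
(* [khat] takes finitely many values, so the loss is a finite combination of indicators of
   measurable events. *)
have mH : measurable_fun [set: T] (fun w => \sum_t h (khat w) t).
  rewrite (_ : (fun _ => _) = (fun w => \sum_j (\sum_t h j t) *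
      \1_[set w | khat w = j] w)); last first.
    apply/funext => w; rewrite (bigD1 (khat w))//= indicE mem_set// mulr1.
    rewrite [X in _ = _ + X]big1 ?addr0// => j jk; rewrite indicE memNset ?mulr0//=.
    by move=> kj; rewrite kj eqxx in jk.
  by apply: measurable_sum => j; apply: measurable_funM.
have mZ j : measurable_fun [set: T] (Z j).
  apply: measurable_funM => //; apply: measurable_fprod => t.
  apply: measurable_fun_ifT => //; first exact: measurable_fun_sampled.
  apply: (measurableT_comp (f := @expR R)) => //; apply: measurable_funN.
  by apply: measurable_funM => //; exact: measurableT_comp.
have Z0 j w : 0 <= Z j w.
  rewrite mulr_ge0 ?expR_ge0//; apply: prodr_ge0 => t _.
  by case: ifP => // _; exact: expR_ge0.
have mS (F : I -> Ys -> R) c : (forall t, measurable_fun [set: Ys] (F t)) ->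
    measurable_fun [set: T] (fun w => c + th2 * \sum_t F t (Yv t w) * \1_(Om t) w).
  move=> mF; apply: measurable_funD => //; apply: measurable_funM => //.
  apply: measurable_sum => t; apply: measurable_funM; first exact: measurableT_comp.
  exact: measurable_indic.
have S0 (F : I -> Ys -> R) c w : 0 <= c -> (forall t y, 0 <= F t y) ->
    0 <= c + th2 * \sum_t F t (Yv t w) * \1_(Om t) w.
  move=> c0 F0; rewrite addr_ge0// mulr_ge0 ?(ltW th2_gt0)//.
  by apply: sumr_ge0 => t _; rewrite mulr_ge0.
have C0 : 0 <= th2 * (xi * pen k) by rewrite !mulr_ge0// ltW.
set X := (\int[P]_w _)%E.
(* The expectation of [oracle_pointwise], with the Kraft inequality bounding the mean of the sum of
   the [Z] by 1. *)
have : (a%:E * X + (1 + th2 * (gamma * \sum_t (V t).2))%:E <=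
    1 + (th2 * (xi * pen k) + th2 * (gamma * \sum_t (V t).1))%:E)%E.
  have <- := @integral_sum_sampled (neg k) (fun t => (V t).2) 1 ler01 mneg neg0
    (fun t => let: And3 _ e _ := HV t in e).
  have <- := @integral_sum_sampled (pos k) (fun t => (V t).1) _ C0 mpos pos0
    (fun t => let: And3 e _ _ := HV t in e).
  have -> : (a%:E * X = \int[P]_w (a%:E * (\sum_t h (khat w) t)%:E))%E.
    rewrite ge0_integralZl//; first exact/measurable_EFinP.
    by move=> w _; rewrite lee_fin.
  rewrite -ge0_integralD//; last 4 first.
  - by move=> w _; rewrite -EFinM lee_fin mulr_ge0.
  - by apply: measurable_funeM; exact/measurable_EFinP.
  - by move=> w _; rewrite lee_fin S0.
  - by apply/measurable_EFinP; exact: mS.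
  apply: (@le_trans _ _ (\int[P]_w (\sum_j Z j w + (th2 * (xi * pen k) +
      th2 * \sum_t pos k t (Yv t w) * \1_(Om t) w))%:E)%E).
    apply: ae_ge0_le_integral => //.
    - by move=> w _; rewrite -EFinM -EFinD lee_fin; apply: addr_ge0; [exact: mulr_ge0|exact: S0].
    - apply: emeasurable_funD; last by apply/measurable_EFinP; exact: mS.
      by apply: measurable_funeM; exact/measurable_EFinP.
    - by move=> w _; rewrite lee_fin; apply: addr_ge0; [exact: sumr_ge0|exact: S0].
    - apply/measurable_EFinP; apply: measurable_funD; last exact: mS.
      exact: measurable_sum.
    by apply: filterS (oracle_pointwise k) => w hw _; rewrite -EFinM -EFinD lee_fin.
  under eq_integral do rewrite EFinD -sumEFin.
  rewrite ge0_integralD//; last 4 first.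
  - by move=> w _; apply: sume_ge0 => j _; rewrite lee_fin.
  - by apply: emeasurable_sum => j; exact/measurable_EFinP.
  - by move=> w _; rewrite lee_fin S0.
  - by apply/measurable_EFinP; exact: mS.
  rewrite leeD2r// ge0_integral_sum//; last 2 first.
  - by move=> j; exact/measurable_EFinP.
  - by move=> j w _; rewrite lee_fin.
  apply: (@le_trans _ _ (\sum_j (expR (- pen j))%:E)%E); last by rewrite sumEFin lee_fin.
  by apply: lee_sum => j _; exact: integral_tilted_lr.
have -> : (\sum_t KL mu (f t) (q k t) = (\sum_t (V t).1 - \sum_t (V t).2)%:E)%E.
  rewrite -sumrB -sumEFin; apply: eq_bigr => t _.
  by have [_ _ ->] := HV t.
have KL0 : 0 <= \sum_t (V t).1 - \sum_t (V t).2.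
  rewrite -sumrB; apply: sumr_ge0 => t _; have [_ _ KLE] := HV t.
  rewrite -lee_fin -KLE; have /andP[h0 _] := hell_rate_bounds k t.
  by apply: le_trans (le_hell_KL (mf t) (mq k t) (f0 t) (q0 k t) (f1 t) (q1 k t) (KLk k t)).
move: KL0; set VP := \sum_t (V t).1; set VN := \sum_t (V t).2 => KL0.
rewrite -leeBrDr// -EFinB => aX.
(* With [s = 2 * kappa / 3], [th2 * kappa] equals [3 / 4] times [s / (1 + s)]. *)
have tk1 : 1 + th2 * kappa <= 7 / 4.
  have -> : th2 * kappa = 3 / 4 * ((2 * kappa / 3) / (1 + 2 * kappa / 3)).
    by rewrite /th2 /theta; field; rewrite gt_eqF//; have := kappa0; lra.
  have : 2 * kappa / 3 / (1 + 2 * kappa / 3) <= 1.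
    by rewrite ler_pdivrMr//; have := kappa0; lra.
  lra.
(* Multiplying by this factor turns [a] into [gamma]. *)
have c0 : 0 <= (1 + th2 * kappa) / th2 by rewrite divr_ge0 ?addr_ge0// ltW.
have c0' : (0 <= ((1 + th2 * kappa) / th2)%:E)%E by rewrite lee_fin.
have := lee_wpmul2l c0' aX; rewrite muleA -EFinM.
have -> : (1 + th2 * kappa) / th2 * a = gamma.
  rewrite /a; field; rewrite !gt_eqF//.
  by rewrite ltr_pwDl.
move=> /le_trans; apply; rewrite -!EFinM lee_fin.
(* The 1 from the Kraft inequality cancels the 1 from [1 + x <= expR x]. *)
rewrite (_ : _ / _ * _ = (1 + th2 * kappa) * (gamma * (VP - VN) + xi * pen k)).
  by rewrite ler_wpM2r// addr_ge0// mulr_ge0.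
by field; rewrite gt_eqF.
Qed.

End oracle.

(** * Kraft inequality for the discretized tensors *)

Lemma code_kraft (R : realType) (S1 S2 : finType) (v : nat) (u : R)
    (nz : 'I_v -> bool) :
  0 <= u -> (#|S1| = 0%N -> #|S2| = 0%N) ->
  (exists l0, forall l, nz l = (l != l0)) ->
  v%:R * u <= 1 / 2 -> #|S2|%:R * (v%:R * u) <= 1 / 2 ->
  \sum_(k : {ffun S1 -> 'I_v} * {ffun S2 -> 'I_v})
     u ^+ (#|S1| + \sum_t nz (k.2 t)) <= 1.
Proof.
move=> u0 S12 [l0 nzE] xle Sx; set x := v%:R * u.
have x0 : 0 <= x by rewrite mulr_ge0.
(* The sum factors into [x ^ |S1|] and a product over [S2] of single-symbol sums, each at most
   [1 + x] because only the symbol [l0] is free. *)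
rewrite -(pair_bigA _ (fun (a : {ffun S1 -> 'I_v}) (a' : {ffun S2 -> 'I_v}) =>
  u ^+ (#|S1| + \sum_t nz (a' t))))/=.
rewrite sumr_const card_ffun card_ord.
under eq_bigr do rewrite exprD.
rewrite -mulr_sumr -mulr_natl mulrA natrX -exprMn -/x.
have -> : \sum_(a : {ffun S2 -> 'I_v}) u ^+ (\sum_t nz (a t)) =
    \prod_(t : S2) \sum_(l : 'I_v) u ^+ nz l.
  rewrite (bigA_distr_bigA (fun (t : S2) l => u ^+ nz l)).
  by apply: eq_bigr => a _; rewrite expr_sum.
rewrite prodr_const.
have s1 : \sum_(l : 'I_v) u ^+ nz l <= 1 + x.
  rewrite (bigD1 l0)//= nzE eqxx expr0 lerD2l.
  rewrite (eq_bigr (fun=> u)); last by move=> l ll0; rewrite nzE ll0.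
  rewrite sumr_const -mulr_natl ler_wpM2r// ler_nat.
  by rewrite (leq_trans (max_card _))// card_ord.
have s0 : 0 <= \sum_(l : 'I_v) u ^+ nz l by apply: sumr_ge0 => l _; exact: exprn_ge0.
(* If [S1] is empty, so is [S2], and the sum is 1; for tensors this is the case [r = 0]. *)
have [S10|S10] := posnP #|S1|.
  by rewrite S10 (S12 S10) !expr0 mulr1.
have h1 : x ^+ #|S1| <= 1 / 2.
  apply: (le_trans _ xle); rewrite -[leRHS]expr1 ler_wiXn2l//.
  by move: xle; rewrite -/x; lra.
(* [(1 + x) ^ |S2| <= expR (|S2| * x)], whose reciprocal is at least [1 - |S2| * x >= 1 / 2]. *)
have h2 : (\sum_(l : 'I_v) u ^+ nz l) ^+ #|S2| <= 2.
  apply: (@le_trans _ _ (expR x ^+ #|S2|)).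
    rewrite lerXn2r ?nnegrE ?expR_ge0//; apply: (le_trans s1); exact: expR_ge1Dx.
  rewrite -expRM_natl -[leRHS]invrK -[X in X <= _]invrK -expRN.
  rewrite lef_pV2 ?posrE ?expR_gt0//.
  apply: le_trans (expR_ge1Dx _); move: Sx; rewrite -/x; lra.
have e0 : 0 <= (\sum_(l : 'I_v) u ^+ nz l) ^+ #|S2| by exact: exprn_ge0.
have := ler_pM (exprn_ge0 _ x0) e0 h1 h2; lra.
Qed.

Lemma vartheta_gt1 (R : realType) (beta : R) (n1 n2 : nat) :
  3 <= beta -> (2 <= n1)%N -> (1 < vartheta beta n1 n2)%N.
Proof.
move=> b3 n12; rewrite /vartheta -{1}(expn0 2) ltn_exp2l// absz_gt0.
rewrite gt_eqF// ceil_gt0 /log2 mulr_gt0 ?(lt_le_trans _ b3)//.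
by rewrite divr_gt0// ln_gt0// ltr1n// leq_max n12.
Qed.

(** The factor 2 pays for rounding the exponent up to its ceiling. *)
Lemma le_vartheta (R : realType) (beta : R) (n1 n2 : nat) :
  0 <= beta -> (2 <= n1)%N ->
  (vartheta beta n1 n2)%:R <= 2 * expR (beta * ln (maxn n1 n2)%:R) :> R.
Proof.
move=> b3 n12; have ln2 : 0 < ln 2 :> R by rewrite ln_gt0// ltr1n.
have n0 : 0 <= ln (maxn n1 n2)%:R :> R.
  by rewrite ln_ge0// ler1n leq_max (ltnW n12).
have l2 : expR (ln 2) = 2 :> R by rewrite lnK ?posrE.
set y := beta * log2 (maxn n1 n2)%:R.
have y0 : 0 <= y by rewrite mulr_ge0// divr_ge0// ltW.
rewrite /vartheta -/y natrX (_ : 2%:R ^+ _ = expR (`|Num.ceil y|%N%:R * ln 2)); last first.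
  by rewrite expRM_natl l2.
rewrite -[X in _ <= X * _]l2 -expRD ler_expR natr_absz ger0_norm; last first.
  by rewrite ceil_ge0 (lt_le_trans (ltrN10 _)).
have /andP[+ _] := ceil_itv y; rewrite intrB => /ltW.
rewrite lerBlDr => h; have := ler_wpM2r (ltW ln2) h.
rewrite mulrDl mul1r => /le_trans; apply.
rewrite addrC lerD2l /y /log2 mulrA mulfVK//; by rewrite gt_eqF.
Qed.

(** With [n] the larger of [n1] and [n2], the exponents add up to
    [- (beta + 2) * ln n - (beta + 1) * ln n3], so the left side is at most [2 / n ^ 2 <= 1 / 2]. *)
Lemma vartheta_kraft_bound (R : realType) (beta : R) (n1 n2 n3 : nat) :
  3 <= beta -> (2 <= n1)%N -> (1 <= n3)%N ->
  (maxn n1 n2 * maxn n1 n2 * n3)%:R * ((vartheta beta n1 n2)%:R *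
    expR (- (2 * (beta + 2) * ln ((maxn n1 n2)%:R * Num.sqrt n3%:R)))) <= 1 / 2 :> R.
Proof.
move=> b3 n12 n31; set n := maxn n1 n2.
have nge2 : (2 <= n)%N by rewrite leq_max n12.
have n0 : 0 < n%:R :> R by rewrite ltr0n (leq_trans _ nge2).
have n30 : 0 < n3%:R :> R by rewrite ltr0n.
have l0 : 0 <= ln n%:R :> R by rewrite ln_ge0// ler1n (ltnW nge2).
have l30 : 0 <= ln n3%:R :> R by rewrite ln_ge0// ler1n.
have -> : ln (n%:R * Num.sqrt n3%:R) = ln n%:R + ln n3%:R / 2 :> R.
  rewrite lnM ?posrE ?sqrtr_gt0//; congr (_ + _).
  by rewrite -{2}(sqr_sqrtr (ltW n30)) lnXn ?sqrtr_gt0//; field.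
have b0 : 0 <= beta by lra.
have := le_vartheta n2 b0 n12; rewrite -/n => vt.
apply: (@le_trans _ _ (expR (ln n%:R + ln n%:R + ln n3%:R) *
   (2 * expR (beta * ln n%:R) * expR (- (2 * (beta + 2) * (ln n%:R + ln n3%:R / 2)))))).
  rewrite !expRD !lnK ?posrE// !natrM ler_wpM2l ?mulr_ge0//.
  by rewrite ler_wpM2r ?expR_ge0.
rewrite -mulrA mulrCA -!expRD.
apply: (@le_trans _ _ (2 * expR (- (2%:R * ln n%:R)))).
  rewrite ler_wpM2l// ler_expR; nra.
rewrite expRN expRM_natl lnK// -ler_pdivlMl//.
rewrite (_ : _^-1 * _ = (2 ^+ 2)^-1); last by field.
rewrite lef_pV2 ?posrE ?exprn_gt0// lerXn2r ?nnegrE// ?ler_nat//.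
Qed.

(** * The tensor loss, and integer codes for discretized tensors *)

Lemma ln_prod_gt0 (R : realType) (I : finType) (F : I -> R) :
  (forall i, 0 < F i) -> ln (\prod_i F i) = \sum_i ln (F i).
Proof.
move=> F0; rewrite (eq_bigr (fun i => expR (ln (F i)))); last first.
  by move=> i _; rewrite lnK ?posrE.
by rewrite -expR_sum expRK.
Qed.

Lemma hellC (R : realType) d (Ys : measurableType d)
    (mu : {measure set Ys -> \bar R}) (p q : Ys -> R) :
  hell mu p q = hell mu q p.
Proof. by rewrite /hell; under eq_integral do rewrite mulrC. Qed.

(** Positive affinities select the finite branch of [m2log]; symmetry of the affinity reconciles the
    two orders of arguments. *)
Lemma m2log_thell (R : realType) d (Ys : measurableType d)
    (mu : {measure set Ys -> \bar R}) (p : R -> Ys -> R) n1 n2 n3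
    (X1 X2 : tensor R n1 n2 n3) :
  (forall t, 0 < hell mu (p (tent X1 t)) (p (tent X2 t))) ->
  m2log (thell mu p X2 X1) =
  (\sum_t (- 2 * ln (hell mu (p (tent X1 t)) (p (tent X2 t)))))%:E.
Proof.
move=> h0; rewrite /m2log /thell.
under eq_bigr do rewrite hellC.
by rewrite prodr_gt0//= ln_prod_gt0// mulr_sumr.
Qed.

Section codes.
Context (R : realType) (v : nat).

(** Integer codes provide a finite type over which to sum and in which a selector can take its
    values. *)
Definition decode (b : R) n1 n2 n3 (a : {ffun tidx n1 n2 n3 -> 'I_v}) :
  tensor R n1 n2 n3 := fun i j k => b * (a (i, j, k))%:R / v.-1%:R.

Lemma decode_level b n1 n2 n3 (B : tensor R n1 n2 n3) :
  (forall i j k, is_level v b (B i j k)) -> exists a, decode b a = B.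
Proof.
move=> lB.
have /choice[g Hg] : forall t : tidx n1 n2 n3, exists l : 'I_v,
    tent B t = b * l%:R / v.-1%:R.
  by move=> t; have [l lv E] := lB t.1.1 t.1.2 t.2; exists (Ordinal lv).
exists (finfun g); apply/funext => i; apply/funext => j; apply/funext => k.
by rewrite /decode ffunE -Hg.
Qed.

Lemma l0norm_decode b n1 n2 n3 (a : {ffun tidx n1 n2 n3 -> 'I_v}) :
  0 < b -> (1 < v)%N ->
  l0norm (decode b a) = (\sum_t (a t != 0 :> nat)%N)%N.
Proof.
move=> b0 v1; rewrite /l0norm -sum1_card big_mkcond/=.
apply: eq_bigr => t _; rewrite (_ : (t \in _) = (tent (decode b a) t != 0)); last first.
  by apply/idP/idP; rewrite inE.
case: t => -[i j] k; rewrite /tent/= /decode/=.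
rewrite mulf_eq0 invr_eq0 !mulf_eq0 !pnatr_eq0 gt_eqF//= -(subn1 v) subn_eq0.
by rewrite leqNgt v1 orbF; case: (_ == _).
Qed.

(* Hence the entries of B need no extra code symbol for the value 0. *)
Lemma is_level0 (b : R) : (0 < v)%N -> is_level v b 0.
Proof. by exists 0%N => //; rewrite mulr0 mul0r. Qed.

End codes.

(** * Application to the discretized tensor factorizations *)

Theorem theorem1 (R : realType) (n1 n2 n3 r : nat) (b c : R)
  (As : tensor R n1 r n3) (Bs : tensor R r n2 n3)
  (m : nat) (beta kappa lam : R)
  (dY : measure_display) (Ys : measurableType dY)
  (mu : {measure set Ys -> \bar R}) (p : R -> Ys -> R)
  (dT : measure_display) (T : measurableType dT) (P : probability T R)
  (Yv : tidx n1 n2 n3 -> T -> Ys) (Om : tidx n1 n2 n3 -> set T)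
  (est : {set tidx n1 n2 n3} -> (tidx n1 n2 n3 -> Ys) ->
         tensor R n1 r n3 * tensor R r n2 n3) :
  (* dimensions and constants *)
  (2 <= n1)%N -> (2 <= n2)%N -> (2 <= n3)%N -> (r <= minn n1 n2)%N ->
  0 < b -> 0 < c ->
  (* the true tensor X* = A* <> B* *)
  (forall i j k, 0 <= As i j k <= 1) ->
  (forall i j k, 0 <= Bs i j k <= b) ->
  (forall i j k, 0 <= tprod As Bs i j k <= c / 2) ->
  (* sample size *)
  (4 <= m <= n1 * n2 * n3)%N ->
  3 <= beta ->
  (* the scalar parametric family: densities wrt the base measure mu *)
  (forall x, 0 <= x <= c ->
     [/\ measurable_fun [set: Ys] (p x), (forall y, 0 <= p x y) &
         (\int[mu]_y (p x y)%:E = 1)%E]) ->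
  (* Omega ~ Bern(gamma), gamma = m / (n1 n2 n3): t \in Omega iff Om t holds *)
  (forall t, measurable (Om t)) ->
  (forall t, P (Om t) = (m%:R / (n1 * n2 * n3)%:R)%:E) ->
  (* observations: Y_t has density p_{X*_t}; all independent of each other
     and of Omega (only Y restricted to Omega is used below) *)
  (forall t, measurable_fun [set: T] (Yv t)) ->
  (forall t (A : set Ys), measurable A ->
     P (Yv t @^-1` A) = (\int[mu]_(y in A) (p (tent (tprod As Bs) t) y)%:E)%E) ->
  mutually_indep P Yv Om ->
  (* kappa bounds the entrywise KL divergences over Gamma *)
  (forall (A : tensor R n1 r n3) (B : tensor R r n2 n3),
     inGamma (vartheta beta n1 n2) b c A B ->
     forall t, (KL mu (p (tent (tprod As Bs) t)) (p (tent (tprod A B) t))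
                <= kappa%:E)%E) ->
  (* regularization parameter *)
  4 * (beta + 2) * (1 + 2 * kappa / 3) *
    ln ((maxn n1 n2)%:R * Num.sqrt (n3%:R)) <= lam ->
  (* the estimator: a (measurable) selection of the penalized argmin over Gamma,
     depending on the data only through (Omega, Y_Omega) *)
  (forall Omega y,
     inGamma (vartheta beta n1 n2) b c (est Omega y).1 (est Omega y).2 /\
     forall (A : tensor R n1 r n3) (B : tensor R r n2 n3),
       inGamma (vartheta beta n1 n2) b c A B ->
       (crit p lam (est Omega y).1 (est Omega y).2 Omega y
        <= crit p lam A B Omega y)%E) ->
  (forall (Omega : {set tidx n1 n2 n3}) (y y' : tidx n1 n2 n3 -> Ys), (forall t, t \in Omega -> y t = y' t) ->
     est Omega y = est Omega y') ->
  (forall v, measurable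
     [set w | est (omset Om w) (fun t => Yv t w) = v]) ->
  (* conclusion: the bound holds against every element of Gamma,
     i.e. against the minimum over Gamma *)
  forall (A : tensor R n1 r n3) (B : tensor R r n2 n3),
    inGamma (vartheta beta n1 n2) b c A B ->
    ((\int[P]_w m2log
        (thell mu p
           (tprod (est (omset Om w) (fun t => Yv t w)).1
                  (est (omset Om w) (fun t => Yv t w)).2)
           (tprod As Bs)))
      * ((n1 * n2 * n3)%:R^-1)%:E
     <= 3%:E *
        (tKL mu p (tprod As Bs) (tprod A B) * ((n1 * n2 * n3)%:R^-1)%:E
         + ((lam + 8 * kappa * (beta + 2) *
                   ln ((maxn n1 n2)%:R * Num.sqrt (n3%:R)) / 3)
            * ((r * n1 * n3 + l0norm B)%:R / m%:R))%:E)
        + (8 * kappa * ln (m%:R) / m%:R)%:E)%E.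
Proof.
move=> n12 n22 n32 rle b0 c0 _ _ Xs /andP[m4 mN] b3 dens mOm POm mYv PYv indep KLk
  lamge est_opt _ mest A B AB.
set Xs' := tprod As Bs in Xs PYv KLk *.
set v := vartheta beta n1 n2 in KLk est_opt AB *.
have v1 : (1 < v)%N by exact: vartheta_gt1.
set L := ln _ in lamge *.
pose dec (k : {ffun tidx n1 r n3 -> 'I_v} * {ffun tidx r n2 n3 -> 'I_v}) :
    tensor R n1 r n3 * tensor R r n2 n3 := (decode 1 k.1, decode b k.2).
pose G : {pred {ffun tidx n1 r n3 -> 'I_v} * {ffun tidx r n2 n3 -> 'I_v}} :=
  fun k => `[< inGamma v b c (dec k).1 (dec k).2 >].
pose K := {k | k \in G}.
have decG (k : K) : inGamma v b c (dec (val k)).1 (dec (val k)).2.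
  by apply/asboolP; exact: (valP k).
have surj V : inGamma v b c V.1 V.2 -> exists k : K, dec (val k) = V.
  case: V => V1 V2 /= VG; have [l1 l2 _] := VG.
  have [a1 a1E] := decode_level l1.
  have l2' i j k : is_level v b (V2 i j k).
    by case: (l2 i j k) => [->|//]; exact: is_level0 (ltnW v1).
  have [a2 a2E] := decode_level l2'.
  have aG : (a1, a2) \in G by apply/asboolP; rewrite /= a1E a2E.
  by exists (exist (fun k => k \in G) (a1, a2) aG); rewrite /dec /= a1E a2E.
have [k0 k0E] := surj (A, B) AB.
(* [enc] chooses a code for each pair in the class, with [k0] as default outside it; it turns [est]
   into a selector [khat] with values in [K]. *)
have [enc encE] : exists enc : tensor R n1 r n3 * tensor R r n2 n3 -> K,
    forall V, inGamma v b c V.1 V.2 -> dec (val (enc V)) = V.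
  suff /choice[enc ?] : forall V : tensor R n1 r n3 * tensor R r n2 n3,
      exists k : K, inGamma v b c V.1 V.2 -> dec (val k) = V by exists enc.
  move=> V; have [VG|VG] := pselect (inGamma v b c V.1 V.2); last by exists k0.
  by have [k kE] := surj V VG; exists k.
pose estw w := est (omset Om w) (fun t => Yv t w).
pose khat w := enc (estw w).
have khatE w : dec (val (khat w)) = estw w.
  by apply: encE; have [] := est_opt (omset Om w) (fun t => Yv t w).
have mkhat k : measurable [set w | khat w = k].
  (* A code that [enc] does not choose gives an empty event; any other gives an event assumed
     measurable for [est]. *)
  have [kk|kk] := pselect (enc (dec (val k)) = k).
    rewrite (_ : [set w | _] = [set w | estw w = dec (val k)]); first exact: mest.
    apply/seteqP; split=> w /=; first by move=> <-; rewrite khatE.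
    by rewrite /khat => ->.
  rewrite (_ : [set w | _] = set0)//; apply/seteqP; split=> w //= wk; apply: kk.
  by rewrite -wk khatE.
have N0 : (0 < n1 * n2 * n3)%N by rewrite !muln_gt0 (ltnW n12) (ltnW n22) (ltnW n32).
have NR0 : 0 < (n1 * n2 * n3)%:R :> R by rewrite ltr0n.
have m0 : 0 < m%:R :> R by rewrite ltr0n (leq_trans _ m4).
set N := (n1 * n2 * n3)%:R in POm NR0 *.
pose gamma : R := m%:R / N.
have gamma01 : 0 <= gamma <= 1.
  apply/andP; split; first by rewrite divr_ge0// ltW.
  by rewrite /gamma ler_pdivrMr// mul1r ler_nat.
have Xs_range t : 0 <= tent Xs' t <= c.
  by have /andP[x0 x1] := Xs t.1.1 t.1.2 t.2; rewrite x0 (le_trans x1)// ler_pdivrMr// ler_peMr ?ltW// ltr1n.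
pose f t := p (tent Xs' t).
pose q (k : K) t := p (tent (tprod (dec (val k)).1 (dec (val k)).2) t).
have q_range (k : K) t : 0 <= tent (tprod (dec (val k)).1 (dec (val k)).2) t <= c.
  by have [_ _] := decG k; exact.
have mf t : measurable_fun [set: Ys] (f t) by have [] := dens _ (Xs_range t).
have f0 t y : 0 <= f t y by have [_ + _] := dens _ (Xs_range t); exact.
have f1 t : (\int[mu]_y (f t y)%:E = 1)%E by have [] := dens _ (Xs_range t).
have mq k t : measurable_fun [set: Ys] (q k t) by have [] := dens _ (q_range k t).
have q0 k t y : 0 <= q k t y by have [_ + _] := dens _ (q_range k t); exact.
have q1 k t : (\int[mu]_y (q k t y)%:E = 1)%E by have [] := dens _ (q_range k t).
have KLq k t : (KL mu (f t) (q k t) <= kappa%:E)%E by exact: KLk (decG k) t.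
have h_gt0 k t : 0 < hell mu (f t) (q k t) by exact: hell_gt0 (KLq k t).
have h_KL k t : (0 <= - 2 * ln (hell mu (f t) (q k t)))
    /\ ((- 2 * ln (hell mu (f t) (q k t)))%:E <= KL mu (f t) (q k t))%E.
  split; last exact: le_hell_KL (KLq k t).
  by rewrite mulNr oppr_ge0 pmulr_rle0// ln_le0// hell_le1.
have KL0 k t : (0 <= KL mu (f t) (q k t))%E.
  by have [h0] := h_KL k t; apply: le_trans; rewrite lee_fin.
(* A single entry suffices to read off [0 <= KL <= kappa]. *)
pose t0 : tidx n1 n2 n3 := (Ordinal (ltnW n12), Ordinal (ltnW n22), Ordinal (ltnW n32)).
have kappa0 : 0 <= kappa by rewrite -lee_fin (le_trans (KL0 k0 t0)).
have L0 : 0 < L.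
  rewrite ln_gt0// (@lt_le_trans _ _ (maxn n1 n2)%:R)//.
    by rewrite ltr1n leq_max n12.
  by rewrite ler_peMr// -[leLHS]sqrtr1 ler_wsqrtr// ler1n ltnW.
pose S := (r * n1 * n3)%N.
pose cst := 2 * (beta + 2) * L.
have beta0 : 0 < beta + 2 by rewrite addr_gt0// (lt_le_trans _ b3).
have cst0 : 0 < cst by rewrite !mulr_gt0.
(* The penalty also charges the number [S] of entries of [A], as the Kraft inequality requires;
   being constant, this leaves the argmin unchanged. *)
pose pen (k : K) : R := cst * (S + l0norm (dec (val k)).2)%:R.
have pen0 k : 0 <= pen k by rewrite mulr_ge0// ltW.
(* Chosen so that the assumed lower bound on [lam] becomes [xige]. *)
pose xi := lam / cst.
have xiE k : xi * pen k = lam * (S + l0norm (dec (val k)).2)%:R.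
  by rewrite /xi /pen mulrA divfK// gt_eqF.
have xige : 2 * (1 + 2 * kappa / 3) <= xi.
  rewrite ler_pdivlMr//; apply: le_trans lamge; rewrite /cst le_eqVlt; apply/orP; left.
  by apply/eqP; ring.
have lam0 : 0 <= lam.
  apply: le_trans lamge; rewrite !mulr_ge0 ?(ltW L0) ?(ltW beta0)//.
  by rewrite addr_ge0// divr_ge0// mulr_ge0.
have kraft : \sum_(k : K) expR (- pen k) <= 1.
  pose F k := expR (- (cst * (S + l0norm (dec k).2)%:R)).
  rewrite -(big_sub G F); apply: (@le_trans _ _ (\sum_k F k)).
    by rewrite [leRHS](bigID (mem G))/= lerDl sumr_ge0// => k _; exact: expR_ge0.
  have FE k : F k = expR (- cst) ^+ (#|{: tidx n1 r n3}| + \sum_t (k.2 t != 0 :> nat)).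
    rewrite /F -mulNr expRM_natr l0norm_decode//; congr (_ ^+ (_ + _)%N).
    by rewrite !card_prod !card_ord /S (mulnC r).
  under eq_bigr do rewrite FE.
  (* One bound covers both sizes required by [code_kraft]: 1, and the number [r * n2 * n3] of
     entries of [B]. *)
  have Kb := vartheta_kraft_bound n2 b3 n12 (ltnW n32).
  rewrite -/L -/cst -/v in Kb.
  set x := v%:R * expR (- cst) in Kb.
  have x0 : 0 <= x by rewrite mulr_ge0// expR_ge0.
  have M1 : (1 <= maxn n1 n2)%N by rewrite leq_max (ltnW n12).
  have xle (z : nat) : (z <= maxn n1 n2 * maxn n1 n2 * n3)%N -> z%:R * x <= 1 / 2.
    by move=> zle; apply: le_trans Kb; rewrite ler_wpM2r// ler_nat.
  apply: (@code_kraft _ _ _ _ _ (fun l => l != 0 :> nat)).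
  - exact: expR_ge0.
  - rewrite !card_prod !card_ord => /eqP; rewrite !muln_eq0.
    by rewrite (gtn_eqF (ltnW n12)) (gtn_eqF (ltnW n32)) orbF/= => /eqP ->.
  - by exists (Ordinal (ltnW v1)) => l; rewrite -val_eqE.
  - by have := xle 1%N; rewrite (mul1r x); apply; rewrite !muln_gt0 M1 (ltnW n32).
  - apply: xle; rewrite !card_prod !card_ord leq_mul// leq_mul ?leq_maxr//.
    by rewrite (leq_trans rle)// geq_min leq_maxl.
have khat_opt (k : K) w :
  (\sum_(t | `[< Om t w >]) mlog (q (khat w) t (Yv t w)) + (xi * pen (khat w))%:E
   <= \sum_(t | `[< Om t w >]) mlog (q k t (Yv t w)) + (xi * pen k)%:E)%E.
  have nllE X : negloglik p X (omset Om w) (fun t => Yv t w) =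
      (\sum_(t | `[< Om t w >]) mlog (p (tent X t) (Yv t w)))%E.
    by apply: eq_bigl => t; rewrite inE.
  have := (est_opt (omset Om w) (fun t => Yv t w)).2 _ _ (decG k).
  rewrite -/(estw w) -khatE /crit !nllE !xiE !natrD !mulrDr !EFinD.
  rewrite ![((lam * S%:R)%:E + _)%E]addeC !addeA => hopt.
  exact: leeD2r.
have := oracle_inequality mOm POm gamma01 mYv mf f0 f1 PYv indep mq q0 q1 KLq kappa0
  pen0 kraft xige mkhat khat_opt k0.
have -> : (\int[P]_w (\sum_t (- 2 * ln (hell mu (f t) (q (khat w) t))))%:E =
   \int[P]_w m2log (thell mu p (tprod (estw w).1 (estw w).2) Xs'))%E.
  by apply: eq_integral => w _; rewrite -khatE m2log_thell// => t; exact: h_gt0.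
set X := (\int[P]_w _)%E.
have [D [D0 DE]] : exists D : R, 0 <= D /\ tKL mu p Xs' (tprod A B) = D%:E.
  exists (\sum_t fine (KL mu (f t) (q k0 t))); split.
    by apply: sumr_ge0 => t _; rewrite fine_ge0.
  rewrite -sumEFin /tKL; apply: eq_bigr => t _; rewrite fineK; first by rewrite /q k0E.
  by rewrite ge0_fin_numE// (le_lt_trans (KLq k0 t))// ltry.
have -> : (\sum_t KL mu (f t) (q k0 t) = D%:E)%E.
  by rewrite -DE /tKL /q k0E.
rewrite DE xiE k0E/= -/S -?EFinM -?EFinD -?EFinM => main.
(* Multiplying the oracle bound by [1 / m] turns [gamma] into the required [1 / N]. *)
have gE : m%:R^-1 * gamma = N^-1 by rewrite /gamma mulKf// gt_eqF.
have -> : (X * (N^-1)%:E = (m%:R^-1)%:E * (gamma%:E * X))%E.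
  by rewrite muleA -EFinM muleC gE.
have m0' : (0 <= (m%:R^-1)%:E :> \bar R)%E by rewrite lee_fin invr_ge0 ltW.
apply: (le_trans (lee_wpmul2l m0' main)); rewrite -?EFinM -?EFinD -?EFinM -?EFinD lee_fin.
set z := (r * n1 * n3 + l0norm B)%:R / m%:R.
have z0 : 0 <= z by rewrite divr_ge0.
have w0 : 0 <= D / N by rewrite divr_ge0// ltW.
have lz : 0 <= lam * z by rewrite mulr_ge0.
have ez : 0 <= 8 * kappa * (beta + 2) * L / 3 * z.
  by rewrite mulr_ge0// divr_ge0// !mulr_ge0// ltW.
have lm : 0 <= 8 * kappa * ln m%:R / m%:R.
  rewrite !mulr_ge0 ?invr_ge0// ?(ltW m0)// ln_ge0// ler1n.
  exact: leq_trans m4.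
(* Since [7 / 4 <= 3], it remains to add the [kappa] terms of the claim, which are nonnegative. *)
rewrite (_ : _^-1 * _ = 7 / 4 * (D / N + lam * z)).
  rewrite [(lam + _) * z]mulrDl; move: (D / N) (lam * z) (_ / 3 * z) (_ / m%:R) w0 lz ez lm.
  by clear => *; lra.
rewrite /z -/gamma -gE -/S; move: (S + l0norm B)%:R m%:R^-1 => s mi.
set g := gamma; clearbody g; ring.
Qed.
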